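(* Let $n,k,k_1,\dots,k_n\ge1$, let $A_j$ be a real $k\times k_j$ matrix for $j=1,\dots,n$, and let $A=(A_1,\dots,A_n)$, a $k\times(k_1+\dots+k_n)$ matrix. Let $\Omega\subset\mathbb{R}^n$ be a rectangular domain (a product of $n$ intervals) with $0\in\Omega$, and let $B:\Omega\to\mathbb{R}$ be smooth. Let $C$ be a symmetric positive definite $k\times k$ matrix. Below, $u_j:\mathbb{R}^{k_j}\to\mathbb{R}$ ($j=1,\dots,n$) denote smooth compactly supported functions such that $\vec u(x)=(u_1(xA_1),\dots,u_n(xA_n))$ maps $\mathbb{R}^k$ into $\Omega$. The following conditions are equivalent: (i) $A^*CA\bullet\mathrm{Hess}\,B\le 0$ on $\Omega$. (ii) $(P_t^CB(\vec u))(x)\le B((P_t^C\vec u)(x))$ for all $t\ge0$, all $x\in\mathbb{R}^k$ and all such $u_1,\dots,u_n$. (iii) $(P_t^CB(\vec u))(x)\le B((P_t^C\vec u)(x))$ for $t=1/2$, $x=0$ and all such $u_1,\dots,u_n$.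
   Context: Elements $x\in\mathbb{R}^k$ are written as row vectors, so $xA_j\in\mathbb{R}^{k_j}$. $A^*CA\bullet\mathrm{Hess}\,B$ denotes the $(\sum_jk_j)\times(\sum_jk_j)$ block matrix $\{A_i^*CA_j\,\partial_{ij}B\}_{i,j=1}^n$, whose $(i,j)$ block is the $k_i\times k_j$ matrix $A_i^*CA_j$ multiplied by the scalar $\partial_{ij}B$. $M\le0$ means negative semidefinite. For $C=(c_{ij})>0$, $P_t^C=e^{tL_C}$ is the heat semigroup generated by $L_C=\sum_{i,j}c_{ij}\frac{\partial^2}{\partial x_i\partial x_j}$ on $\mathbb{R}^k$: for bounded continuous $f$, $(P^C_tf)(x)=\int_{\mathbb{R}^k}f(x+\sqrt{2t}\,yC^{1/2})\,d\gamma_k(y)$, where $\gamma_k$ is the standard Gaussian measure on $\mathbb{R}^k$. $P_t^C$ acts on the vector function $\vec u$ componentwise. *)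

(* Defs.v *)
From HB Require Import structures.
From mathcomp Require Import all_boot all_order all_algebra.
From mathcomp Require Import all_classical all_reals all_analysis.

Set Implicit Arguments.
Unset Strict Implicit.
Unset Printing Implicit Defensive.
Import Order.TTheory GRing.Theory Num.Theory.
Import numFieldNormedType.Exports.
Local Open Scope classical_set_scope.
Local Open Scope ring_scope.

Section Matrices.
Context {R : realType}.

Definition posdefmx m (M : 'M[R]_m) : Prop :=
  forall v : 'rV[R]_m, v != 0 -> 0 < (v *m M *m v^T) 0 0.

Definition possemidefmx m (M : 'M[R]_m) : Prop :=
  forall v : 'rV[R]_m, 0 <= (v *m M *m v^T) 0 0.

Definition negsemidefmx m (M : 'M[R]_m) : Prop :=
  forall v : 'rV[R]_m, (v *m M *m v^T) 0 0 <= 0.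

(* The square root $M^{1/2}$: the unique symmetric positive semidefinite S with
   S *m S = M, which exists whenever M is symmetric positive semidefinite. *)
Definition sqrtmx m (M : 'M[R]_m) : 'M[R]_m :=
  xget 0 [set S : 'M[R]_m | [/\ S^T = S, possemidefmx S & S *m S = M]].

End Matrices.

Section Calculus.
Context {R : realType}.

Definition partial m (i : 'I_m) (f : 'rV[R]_m -> R) : 'rV[R]_m -> R :=
  'D_(delta_mx 0 i) f.

Definition hessian m (f : 'rV[R]_m -> R) (x : 'rV[R]_m) : 'M[R]_m :=
  \matrix_(i, j) partial i (partial j f) x.

(* $C^\infty$ on U: the partial derivatives of all orders (including order 0)
   are differentiable on U. *)
Definition smooth_on m (U : set 'rV[R]_m) (f : 'rV[R]_m -> R) : Prop :=
  forall (s : seq 'I_m) (x : 'rV[R]_m),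
    U x -> differentiable (foldr (fun i g => partial i g) f s) x.

Definition compactly_supported m (f : 'rV[R]_m -> R) : Prop :=
  compact (closure [set x | f x != 0]).

End Calculus.

Section ProductProbability.
Context d1 d2 (T1 : measurableType d1) (T2 : measurableType d2) (R : realType).
Variables (P1 : probability T1 R) (P2 : probability T2 R).

Definition prodprob : set (T1 * T2) -> \bar R := (P1 \x P2)%E.

HB.instance Definition _ := Measure.on prodprob.

Let prodprob_setT : prodprob [set: T1 * T2] = 1%E.
Proof.
rewrite -setXTT [LHS]product_measure1E// -[RHS]mule1.
by congr (_ * _)%E; exact: probability_setT.
Qed.

HB.instance Definition _ :=
  Measure_isProbability.Build _ _ _ prodprob prodprob_setT.

End ProductProbability.

Section StdNormal.
Context (R : realType).

(* normal_prob lives on the alias measurableTypeR R of R; this is the same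
   measure on R itself. *)
Definition std_normal : set R -> \bar R := normal_prob 0 1.

Let std_normal0 : std_normal set0 = 0%E.
Proof. exact: measure0. Qed.

Let std_normal_ge0 A : (0 <= std_normal A)%E.
Proof. exact: (@measure_ge0 _ _ _ (normal_prob 0 1)). Qed.

Let std_normal_sigma_additive : semi_sigma_additive std_normal.
Proof. exact: (@measure_semi_sigma_additive _ _ _ (normal_prob 0 1)). Qed.

HB.instance Definition _ := isMeasure.Build _ R _ std_normal
  std_normal0 std_normal_ge0 std_normal_sigma_additive.

Let std_normal_setT : std_normal [set: R] = 1%E.
Proof. exact: (@probability_setT _ _ _ (normal_prob 0 1)). Qed.

HB.instance Definition _ :=
  @Measure_isProbability.Build _ R _ std_normal std_normal_setT.

End StdNormal.

Section HeatSemigroup.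
Context {R : realType}.

Definition cons_pair k (p : R * k.-tuple R) : k.+1.-tuple R :=
  [tuple of p.1 :: p.2].

Lemma measurable_cons_pair k :
  measurable_fun [set: R * k.-tuple R] (@cons_pair k).
Proof. exact: measurable_cons. Qed.

HB.instance Definition _ k := isMeasurableFun.Build _ _ _ _ (@cons_pair k)
  (@measurable_cons_pair k).

(* The k-fold product of N(0, 1). It lives on k.-tuple R, which carries the
   product sigma-algebra, whereas 'rV[R]_k has no measurable structure. *)
Fixpoint std_gauss k : probability (k.-tuple R) R :=
  match k with
  | 0 => \d_ ([tuple] : 0.-tuple R)
  | k'.+1 => distribution (prodprob (@std_normal R) (std_gauss k'))
                          (@cons_pair k')
  end.

Definition row_of_tuple k (y : k.-tuple R) : 'rV[R]_k := \row_i tnth y i.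

(* $P^C_t f$, for bounded continuous f and t >= 0. *)
Definition heat k (C : 'M[R]_k) (t : R) (f : 'rV[R]_k -> R) (x : 'rV[R]_k) : R :=
  (\int[std_gauss k]_y
     f (x + Num.sqrt (2 * t) *: (row_of_tuple y *m sqrtmx C)))%R.

Definition heat_vec k n (C : 'M[R]_k) (t : R) (F : 'rV[R]_k -> 'rV[R]_n)
    (x : 'rV[R]_k) : 'rV[R]_n :=
  \row_j heat C t (fun y => F y 0 j) x.

End HeatSemigroup.

Section Setting.
Context {R : realType} {n k : nat} {k_ : 'I_n -> nat}.

(* Sides may be open, half-open, closed or unbounded. A function counts as smooth
   on such a set when it is smooth on an open set containing it. *)
Definition rectangle (I : 'I_n -> interval R) : set 'rV[R]_n :=
  [set z | forall j, z 0 j \in I j].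

(* $A^*CA \bullet H$: the block matrix whose (i, j) block is
   $H_{ij} A_i^* C A_j$. *)
Definition block_hadamard (A : forall j, 'M[R]_(k, k_ j)) (C : 'M[R]_k)
    (H : 'M[R]_n) : 'M[R]_(\sum_j k_ j) :=
  \mxblock_(i, j) (H i j *: ((A i)^T *m C *m A j)).

Definition joint (A : forall j, 'M[R]_(k, k_ j))
    (u : forall j, 'rV[R]_(k_ j) -> R) (x : 'rV[R]_k) : 'rV[R]_n :=
  \row_j u j (x *m A j).

Definition admissible (A : forall j, 'M[R]_(k, k_ j)) (Omega : set 'rV[R]_n)
    (u : forall j, 'rV[R]_(k_ j) -> R) : Prop :=
  (forall j, smooth_on setT (u j) /\ compactly_supported (u j)) /\
  (forall x, Omega (joint A u x)).

End Setting.

(* Main.v *)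
(* The proof never differentiates the semigroup. Let v = (v_1, ..., v_n) with
   v_j(x) depending on x A_j only, and let s^2 = 2e. A second-order Taylor
   expansion of B at the point P_e v(x), where the linear term averages to zero,
   gives
     P_e (B o v)(x) = B (P_e v(x)) + e * q + O(e^(3/2)),
   where q is the quadratic form of A^*CA . Hess B evaluated at the gradients of
   the v_j, and the error depends only on bounds on v that averaging preserves.
   (i) => (ii): cut [0, t] into N steps of length t / N; by the semigroup property
   the total loss is N * O((t / N)^(3/2)), which tends to 0.
   (iii) => (i): let u_j be bump functions with u_j(0) = z_j and prescribed
   gradients at 0. The value at 0 and time 1/2 for u(s .) is the value at time
   s^2 / 2 for u, so dividing the expansion by s^2 and letting s -> 0 gives (i) at
   z when z is interior; boundary points follow by continuity. *)
Require Import Defs.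
From HB Require Import structures.
From mathcomp Require Import all_boot all_order all_algebra.
From mathcomp Require complex polyrcf.
From mathcomp Require Import sesquilinear spectral.
From mathcomp Require Import all_classical all_reals all_analysis.
From mathcomp Require Import measurable_realfun.
From mathcomp Require Import ring lra.

Set Implicit Arguments.
Unset Strict Implicit.
Unset Printing Implicit Defensive.
Import Order.TTheory GRing.Theory Num.Theory.
Import numFieldNormedType.Exports.
Local Open Scope classical_set_scope.
Local Open Scope ring_scope.

(** * Square roots of positive semidefinite matrices *)

(** The expansion is centred at the averaged point because around v(x) the linear Taylor term of B
    would contribute at order e and bring in second derivatives of the v_j. After a single step v is
    no longer built from compactly supported functions, so the iteration runs over a class given by
    inequalities alone ([tame]); one error constant then serves all N steps. Since Omega may be open
    or unbounded, the derivatives of B need not be bounded on it: all values are confined beforehand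
    to a compact box inside Omega, which is convex, as Taylor's formula requires, and which
    averaging does not leave. Two symmetries of the Gaussian measure carry the computation: rotation
    invariance yields the semigroup law, reflection invariance kills the odd moments. Both are
    obtained for nonnegative integrands by Tonelli and then transferred to bounded or integrable
    ones. [sqrtmx] is defined by choice, so a root has to be exhibited before S S = C can be
    used. *)

Lemma interpolation_poly (F : fieldType) (s : seq F) (g : F -> F) :
  exists p : {poly F}, forall x, x \in s -> p.[x] = g x.
Proof.
elim: s => [|a s [p ph]]; first by exists 0.
case: (boolP (a \in s)) => [as_|nas].
  by exists p => x; rewrite inE => /predU1P[->|]; exact: ph.
pose q := \prod_(b <- s) ('X - b%:P).
have qa : q.[a] != 0.
  by rewrite -[_ == 0]/(root q a) root_prod_XsubC.
(* Newton's form of interpolation: the correction vanishes on [s] and repairs the value at [a]. *)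
exists (p + ((g a - p.[a]) / q.[a]) *: q) => x; rewrite inE => /predU1P[->|xs].
  by rewrite hornerD hornerZ divfK// addrC subrK.
have /rootP q0 : root q x by rewrite root_prod_XsubC.
by rewrite hornerD hornerZ q0 mulr0 addr0 ph.
Qed.

Section Sqrt.
Import mathcomp.real_closed.complex.
Context {R : realType}.
Local Notation f := (@complex.real_complex R).

(** Over the complex numbers M is unitarily diagonalizable with real spectrum, so q(M) is conjugate
    to the diagonal matrix of the values of q at the eigenvalues. The embedding of real matrices is
    injective, which brings the conclusion back to R. *)
Lemma symmetric_horner_eq0 n (M : 'M[R]_n.+1) (q : {poly R}) :
  M^T = M -> (forall a, eigenvalue M a -> q.[a] = 0) -> horner_mx M q = 0.
Proof.
move=> symM q0.
pose M' := map_mx f M.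
have M'h : M' \is hermsymmx.
  apply: realsym_hermsym.
    apply/is_hermitianmxP; rewrite expr0 scale1r map_mx_id//.
    by rewrite /M' map_trmx symM.
  apply/mxOverP => i j; rewrite !mxE.
  by apply/CrealP; rewrite /=; congr (complex.Complex _ _); rewrite oppr0.
have dr := hermitian_spectral_diag_real M'h.
have /hermitian_normalmx/orthomx_spectralP M'E := M'h.
set P := spectralmx M' in M'E dr; set d := spectral_diag M' in M'E dr.
have Pu : P \in unitmx by apply: spectral_unit.
apply: (@map_mx_inj _ _ f); rewrite map_mx0 map_horner_mx.
rewrite -/M' M'E horner_mx_uconjC// horner_mx_diag.
suff -> : map_mx (horner (map_poly f q)) d = 0.
  by rewrite (_ : diag_mx 0 = 0) ?mulmx0 ?mul0mx//; apply/matrixP => i j; rewrite !mxE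
      mul0rn.
apply/rowP => i; rewrite !mxE.
have /mxOverP/(_ 0 i) di := dr.
have dE : d 0 i = f (complex.Re (d 0 i)).
  case: (d 0 i) di => a b /CrealP /=.
  by move=> [bN]; have -> : b = 0 by lra.
rewrite dE horner_map/= q0 ?rmorph0//.
suff : eigenvalue M' (d 0 i) by rewrite dE eigenvalue_map.
(* The i-th row of the spectral basis is an eigenvector; it is nonzero because P is invertible. *)
apply/eigenvalueP; exists (row i P).
  rewrite -row_mul {1}M'E !mulmxA mulmxV// mul1mx.
  by rewrite row_mul row_diag_mx -scalemxAl -rowE.
apply/eqP => r0; move: Pu; rewrite -row_free_unit => /row_freeP[Q PQ].
have := congr1 (row i) PQ; rewrite row_mul r0 mul0mx.
by move/rowP/(_ i); rewrite !mxE eqxx => /eqP; rewrite eq_sym oner_eq0.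
Qed.

Lemma mulmx_trmx_ge0 n (v : 'rV[R]_n) : 0 <= (v *m v^T) 0 0.
Proof. by rewrite mxE sumr_ge0// => i _; rewrite mxE -expr2 sqr_ge0. Qed.

Lemma mulmx_trmx_gt0 n (v : 'rV[R]_n) : v != 0 -> 0 < (v *m v^T) 0 0.
Proof.
move=> v0; rewrite lt0r mulmx_trmx_ge0 andbT; apply: contra v0.
rewrite mxE psumr_eq0; last by move=> i _; rewrite mxE -expr2 sqr_ge0.
move=> /allP h; apply/eqP/rowP => i; rewrite mxE.
by have := h i (mem_index_enum _); rewrite mxE -expr2 sqrf_eq0 => /eqP.
Qed.

(* The root is Q^2, where Q = p(M) and p interpolates the fourth root on the
   spectrum, so that it is symmetric and positive semidefinite by construction. *)
Lemma sqrtmx_exists n (M : 'M[R]_n) : M^T = M -> possemidefmx M ->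
  exists S : 'M[R]_n, [/\ S^T = S, possemidefmx S & S *m S = M].
Proof.
case: n M => [|n] M symM psdM.
  exists 0; split; rewrite ?trmx0 ?[0 *m 0]thinmx0 ?[M]thinmx0// => v.
  by rewrite mulmx0 mul0mx mxE.
have evs_ge0 a : eigenvalue M a -> 0 <= a.
  move=> /eigenvalueP[v vM v0]; have := psdM v.
  by rewrite vM -scalemxAl mxE pmulr_lge0// mulmx_trmx_gt0.
have [s hs] : exists s : seq R, forall a, eigenvalue M a -> a \in s.
  have c0 : char_poly M != 0 by exact/monic_neq0/char_poly_monic.
  exists (polyrcf.rootsR (char_poly M)) => a; rewrite eigenvalue_root_char => ra.
  by rewrite -(polyrcf.roots_on_rootsR c0).
have [p ph] := interpolation_poly s (fun a => Num.sqrt (Num.sqrt a)).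
pose Q := horner_mx M p.
have symQ : Q^T = Q.
  rewrite /Q; elim/poly_ind: p {ph Q} => [|p c IH].
    by rewrite rmorph0 trmx0.
  rewrite rmorphD rmorphM/= horner_mx_X horner_mx_C linearD/= tr_scalar_mx.
  congr (_ + _); rewrite trmx_mul symM IH.
  by apply/esym/comm_horner_mx.
exists (Q *m Q); split.
- by rewrite trmx_mul symQ.
- by move=> v; rewrite mulmxA -mulmxA -{2}symQ -trmx_mul mulmx_trmx_ge0.
(* The spectrum is nonnegative, so the fourth power of the interpolated root gives back each
   eigenvalue; hence Q^4 = M. *)
have eq0 : horner_mx M (p ^+ 4 - 'X) = 0.
  apply: symmetric_horner_eq0 => // a ea; rewrite !hornerE ph ?hs//.
  have a0 := evs_ge0 _ ea.
  by rewrite (exprM _ 2 2) !sqr_sqrtr ?sqrtr_ge0// subrr.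
move: eq0; rewrite rmorphB rmorphXn/= horner_mx_X => /eqP; rewrite subr_eq0 => /eqP <-.
by rewrite -/Q -[RHS]/(Q ^+ 4) (exprD _ 2 2) expr2.
Qed.

Lemma sqrtmxP n (M : 'M[R]_n) : M^T = M -> possemidefmx M ->
  [/\ (sqrtmx M)^T = sqrtmx M, possemidefmx (sqrtmx M) &
      sqrtmx M *m sqrtmx M = M].
Proof.
move=> symM psdM; rewrite /sqrtmx; case: xgetP => [S -> //|/= noS].
by have [S /noS] := sqrtmx_exists symM psdM.
Qed.

End Sqrt.

(** * The standard normal law *)

Section Gauss1.
Context {R : realType}.
Local Notation mu := (@lebesgue_measure R).
Local Notation gam := (@std_normal R).
Local Notation phi := (@normal_pdf R 0 1).
Implicit Types (f : R -> \bar R).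
Local Open Scope ereal_scope.

(* [std_normal] is a measure on R and [normal_prob] one on [measurableTypeR R];
   they have different displays, hence the transfer along the identity. *)
Lemma ge0_integral_std_normal f : measurable_fun setT f ->
  (forall x, 0 <= f x) ->
  \int[gam]_x f x = \int[mu]_x (f x * (phi x)%:E).
Proof.
move=> mf f0.
have dom := @normal_prob_dominates R 0 1.
have mphi : measurable_fun setT (EFin \o phi).
  apply/measurable_EFinP; exact: measurable_normal_pdf.
pose rn := Radon_Nikodym_SigmaFinite.f (normal_prob 0 1) mu.
(* The Radon-Nikodym derivative and the density have the same integral over every measurable set. *)
have rnE : ae_eq mu setT rn (EFin \o phi).
  apply: integral_ae_eq => //.
  - exact: Radon_Nikodym_SigmaFinite.f_integrable.
  - by move=> E _ mE; rewrite -Radon_Nikodym_SigmaFinite.f_integral.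
have mid : measurable_fun setT (idfun : measurableTypeR R -> R).
  by move=> _ A mA; rewrite setTI.
have -> : \int[gam]_x f x = \int[normal_prob 0 1]_x f x.
  transitivity (\int[pushforward (normal_prob 0 1) (idfun : measurableTypeR R -> R)]_x f
      x); first by [].
  by rewrite ge0_integral_pushforward.
rewrite -(Radon_Nikodym_SigmaFinite.change_of_variables dom)//.
apply: ae_eq_integral => //.
- apply: emeasurable_funM => //; apply: (measurable_int mu).
  exact: Radon_Nikodym_SigmaFinite.f_integrable.
- exact: emeasurable_funM.
- exact: ae_eqe_mul2l.
Qed.

(** The image of Lebesgue measure under x -> c x + d, multiplied by |c|, agrees with Lebesgue
    measure on half-open intervals, hence everywhere by uniqueness. *)
Lemma ge0_integral_lebesgue_affine f (c d : R) : c != 0%R ->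
  measurable_fun setT f -> (forall x, 0 <= f x) ->
  \int[mu]_x f x = `|c|%R%:E * \int[mu]_x f (c * x + d)%R.
Proof.
move=> c0 mf f0.
pose h : measurableTypeR R -> measurableTypeR R := (fun x => c * x + d)%R.
have mh : measurable_fun setT h.
  by apply: measurable_funD => //; exact: measurable_funM.
pose nc : {nonneg R} := NngNum (normr_ge0 c).
pose nu := mscale nc (measure_function_pushforward__canonical__measure_function_Measure
    mu mh).
have nuE A : measurable A -> mu A = nu A.
  apply: (@lebesgue_measure_unique R nu) => _ [[a b] _ <-]/=.
  rewrite /nu/= /mscale/= /pushforward/=.
  have [cgt0|clt0] : (0 < c \/ c < 0)%R by move: c0; rewrite neq_lt => /orP[]; [right|left].
  - have -> : h @^-1` `]a, b]%classic = `]((a - d) / c)%R, ((b - d) / c)%R]%classic.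
      apply/seteqP; split=> x /=; rewrite !in_itv/= /h ltr_pdivrMr// ler_pdivlMr//;
        by rewrite ltrBlDr lerBrDr mulrC.
    rewrite !lebesgue_measure_itv/= !lte_fin ltr_pM2r ?invr_gt0// ltrD2r.
    case: ifPn => _; last by rewrite mule0.
    by rewrite -!EFinB -EFinM gtr0_norm//; congr (_%:E); field.
  (* For c < 0 the open end of the preimage changes sides, which does not affect its length. *)
  - have -> : h @^-1` `]a, b]%classic = `[((b - d) / c)%R, ((a - d) / c)%R[%classic.
      apply/seteqP; split=> x /=; rewrite !in_itv/= /h ler_ndivrMr// ltr_ndivlMr//;
        by rewrite ltrBlDr lerBrDr mulrC andbC.
    rewrite !lebesgue_measure_itv/= !lte_fin ltr_nM2r ?invr_lt0// ltrD2r.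
    case: ifPn => _; last by rewrite mule0.
    by rewrite -!EFinB -EFinM ltr0_norm//; congr (_%:E); field.
transitivity (\int[nu]_x f x).
  by apply: eq_measure_integral => A mA _; exact: nuE.
rewrite ge0_integral_mscale//=.
by rewrite ge0_integral_pushforward.
Qed.

(* Invariance of the density under the rotation by the angle with cosine b / c. *)
Lemma std_normal_pdf_rotation (a b c x z : R) : (b != 0)%R -> (
  a ^+ 2 + b ^+ 2 = c ^+ 2)%R -> (
  phi (c / b * z + - (a / b * x)) * phi x =
  phi z * phi (c / b * x + - (a / b * z)))%R.
Proof.
move=> b0 abc; rewrite !normal_pdfE ?oner_eq0// /normal_fun.
rewrite !subr0 mulrACA [RHS]mulrACA -!expRD; congr (_ * expR _)%R.
have cE : (c ^+ 2 = a ^+ 2 + b ^+ 2)%R by rewrite abc.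
have E (u v : R) : (- u ^+ 2 / (1 ^+ 2 *+ 2) + - v ^+ 2 / (1 ^+ 2 *+ 2) = - (u ^+ 2 + v
    ^+ 2) / 2)%R.
  by rewrite expr1n; field.
rewrite !E; congr (- _ / _)%R.
have -> : ((c / b * z + - (a / b * x)) ^+ 2 + x ^+ 2 =
  c ^+ 2 / b ^+ 2 * z ^+ 2 - 2 * c * a / b ^+ 2 * x * z + (a ^+ 2 + b ^+ 2) / b ^+ 2 * x
      ^+ 2)%R.
  by field.
rewrite cE; have -> : (z ^+ 2 + (c / b * x + - (a / b * z)) ^+ 2 =
  c ^+ 2 / b ^+ 2 * x ^+ 2 - 2 * c * a / b ^+ 2 * x * z + (a ^+ 2 + b ^+ 2) / b ^+ 2 * z
      ^+ 2)%R.
  by field.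
by rewrite cE; field.
Qed.

(** A rotation of the plane done one variable at a time: the substitution y = (c z - a x) / b in the
    inner integral, followed by the rotation identity for the densities, leaves after Tonelli a
    Gaussian factor in x of total mass 1. *)
Lemma std_normal_conv f (a b c : R) : (0 < b)%R -> (0 <= c)%R ->
  (a ^+ 2 + b ^+ 2 = c ^+ 2)%R ->
  measurable_fun setT f -> (forall x, 0 <= f x) ->
  \int[gam]_x \int[gam]_y f (a * x + b * y)%R = \int[gam]_z f (c * z)%R.
Proof.
move=> b0 c0 abc mf f0.
have cgt0 : (0 < c)%R by rewrite lt_neqAle c0 andbT; apply/eqP => c00; nra.
have mphi : measurable_fun setT phi by exact: measurable_normal_pdf.
have phi0 x : 0 <= (phi x)%:E by rewrite lee_fin normal_pdf_ge0.
have mlin (u v : R) : measurable_fun [set: measurableTypeR R * measurableTypeR R] (fun p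
    => u * p.1 + v * p.2)%R.
  by apply: measurable_funD; apply: measurable_funM.
have mlin1 (u v : R) : measurable_fun [set: measurableTypeR R] (fun y => u + v * y)%R.
  by apply: measurable_funD => //; apply: measurable_funM.
have cb0 : (0 < c / b)%R by rewrite divr_gt0.
have mfl (u v : R) : measurable_fun [set: measurableTypeR R] (fun y => f (u + v * y)%R).
  by apply: (measurableT_comp mf); exact: mlin1.
have mfl0 (v : R) : measurable_fun [set: measurableTypeR R] (fun y => f (v * y)%R).
  by under eq_fun do rewrite -[X in f X]add0r; exact: mfl.
have mphil (u v : R) : measurable_fun [set: measurableTypeR R] (fun y => (phi (v * y +
    u))%:E).
  apply/measurable_EFinP; apply: (measurableT_comp mphi).
  by under eq_fun do rewrite addrC; exact: mlin1.
have mphi1 : measurable_fun [set: measurableTypeR R] (fun y => (phi y)%:E).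
  exact/measurable_EFinP.
have inner (x : R) : \int[gam]_y f (a * x + b * y)%R =
    \int[mu]_z ((c / b)%:E * (f (c * z)%R * (phi (c / b * z + - (a / b * x)))%:E)).
  rewrite ge0_integral_std_normal//; last exact: mfl.
  rewrite (@ge0_integral_lebesgue_affine _ (c / b) (- (a / b * x))); last 3 first.
  - by rewrite gt_eqF.
  - by apply: emeasurable_funM => //; exact: mfl.
  - by move=> y; rewrite mule_ge0.
  rewrite -ge0_integralZl//=; last 2 first.
  - apply: emeasurable_funM; last exact: mphil.
    apply: (measurableT_comp (mfl (a * x)%R b)).
    by apply: measurable_funD => //; exact: measurable_funM.
  - by move=> y _; rewrite mule_ge0.
  apply: eq_integral => z _.
  rewrite gtr0_norm//; congr (_ * (f _ * _)).
  by field; rewrite gt_eqF.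
rewrite ge0_integral_std_normal; last 2 first.
- apply: (@measurable_fun_fubini_tonelli_F _ _ R R R gam (fun p => f (a * p.1 + b *
    p.2)%R)) => //.
  apply: (measurableT_comp mf).
  by apply: measurable_funD; apply: measurable_funM.
- by move=> x; exact: integral_ge0.
transitivity (\int[mu]_x \int[mu]_z
   (f (c * z)%R * (phi z)%:E * (`|c / b|%:E * (phi (c / b * x + - (a / b * z)))%:E))).
  apply: eq_integral => x _; rewrite inner -ge0_integralZr//; last 2 first.
  - apply: emeasurable_funM => //; apply: emeasurable_funM => //.
  - by move=> z _; rewrite mule_ge0 ?lee_fin ?(ltW cb0)// mule_ge0.
  apply: eq_integral => z _.
  rewrite gtr0_norm// -!muleA muleCA; congr (_ * _).
  rewrite [RHS]muleCA; congr (_ * _).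
  by rewrite -!EFinM std_normal_pdf_rotation// gt_eqF.
have mK2 : measurable_fun [set: measurableTypeR R * measurableTypeR R]
    (fun p => (phi (c / b * p.1 + - (a / b * p.2)))%:E).
  apply/measurable_EFinP; apply: (measurableT_comp mphi).
  by under eq_fun do rewrite -mulNr; exact: mlin.
rewrite (fubini_tonelli (fun p : measurableTypeR R * measurableTypeR R =>
   (f (c * p.2)%R * (phi p.2)%:E * (`|c / b|%:E * (phi (c / b * p.1 + - (a / b *
       p.2)))%:E))))/=; last 2 first.
- apply: emeasurable_funM; last by apply: emeasurable_funM.
  apply: emeasurable_funM; first by apply: (measurableT_comp mf); apply: measurable_funM.
  by apply: (measurableT_comp mphi1).
- by move=> p; rewrite !mule_ge0.
have mfc : measurable_fun [set: R] (fun y => f (c * y)%R).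
  by apply: (measurableT_comp mf); apply: measurable_funM.
rewrite ge0_integral_std_normal//.
apply: eq_integral => z _.
rewrite ge0_integralZl//; last 3 first.
- by apply: emeasurable_funM.
- by move=> x _; rewrite mule_ge0.
- by rewrite mule_ge0.
rewrite ge0_integralZl//.
rewrite -(@ge0_integral_lebesgue_affine (EFin \o phi))//; last by rewrite gt_eqF.
by rewrite integral_normal_pdf mule1.
Qed.

Lemma std_normal_opp f : measurable_fun setT f -> (forall x, 0 <= f x) ->
  \int[gam]_x f (- (x : R))%R = \int[gam]_x f x.
Proof.
move=> mf f0.
have mphi : measurable_fun [set: measurableTypeR R] (fun y => (phi y)%:E).
  by apply/measurable_EFinP; exact: measurable_normal_pdf.
have phi0 x : 0 <= (phi x)%:E by rewrite lee_fin normal_pdf_ge0.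
have mfN : measurable_fun setT (fun x : R => f (- x)%R).
  by apply: (measurableT_comp mf).
rewrite !ge0_integral_std_normal//.
rewrite [RHS](@ge0_integral_lebesgue_affine _ (- 1) 0) ?oppr_eq0 ?oner_eq0//; last 2 first.
- exact: emeasurable_funM.
- by move=> x; rewrite mule_ge0.
rewrite normrN normr1 mul1e; apply: eq_integral => x _.
rewrite mulN1r addr0; congr (_ * _%:E).
by rewrite !normal_pdfE ?oner_eq0// /normal_fun !subr0 sqrrN.
Qed.

Lemma std_normal_expR_abs : \int[gam]_x (expR `|x|)%:E < +oo.
Proof.
have mphi s : measurable_fun [set: measurableTypeR R] (fun y => (normal_pdf 0 s y)%:E).
  by apply/measurable_EFinP; exact: measurable_normal_pdf.
have me : measurable_fun [set: R] (fun x => (expR `|x|)%:E).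
  by apply/measurable_EFinP; apply: measurableT_comp => //; exact: measurableT_comp.
rewrite ge0_integral_std_normal => [|//|x]; last by rewrite lee_fin expR_ge0.
(* Comparison with the law of variance 2: the inequality |x| - x^2/2 <= 1 - x^2/4 amounts to (|x| -
   2)^2 >= 0. *)
pose s := Num.sqrt 2 : R.
have s2 : (s ^+ 2 = 2)%R by rewrite sqr_sqrtr.
have s0 : (s != 0)%R by rewrite gt_eqF// sqrtr_gt0.
pose K := (expR 1 * normal_peak 1 / normal_peak s)%R : R.
have K0 : (0 <= K)%R by rewrite !mulr_ge0 ?expR_ge0 ?normal_peak_ge0// invr_ge0
    normal_peak_ge0.
apply: (@le_lt_trans _ _ (\int[mu]_x (K%:E * (normal_pdf 0 s x)%:E))); last first.
  rewrite ge0_integralZl// => [|x _]; last by rewrite lee_fin normal_pdf_ge0.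
  by rewrite integral_normal_pdf mule1 ltry.
apply: ge0_le_integral => //.
- by move=> x _; rewrite mule_ge0// lee_fin ?expR_ge0 ?normal_pdf_ge0.
- by apply: emeasurable_funM.
- by apply: emeasurable_funM.
move=> x _; rewrite -!EFinM lee_fin /K !normal_pdfE ?oner_eq0// /normal_fun subr0.
rewrite [leRHS]mulrA divfK; last by rewrite gt_eqF// normal_peak_gt0.
rewrite mulrCA [leRHS]mulrAC -expRD [leRHS]mulrC ler_wpM2l ?normal_peak_ge0//.
rewrite -expRD ler_expR expr1n s2.
have := sqr_ge0 (`|x| - 2)%R; rewrite sqrrB real_normK ?num_real//; lra.
Qed.

Lemma std_normal_sqr_gt0 : 0 < \int[gam]_x (x ^+ 2)%:E.
Proof.
have mphi : measurable_fun [set: measurableTypeR R] (fun y => (phi y)%:E).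
  by apply/measurable_EFinP; exact: measurable_normal_pdf.
have m2 : measurable_fun [set: R] (fun x => (x ^+ 2)%:E).
  by apply/measurable_EFinP; exact: measurable_funX.
rewrite ge0_integral_std_normal => [|//|x]; last by rewrite lee_fin sqr_ge0.
(* On [1, 2] the integrand x^2 phi(x) is at least phi(2). *)
apply: (@lt_le_trans _ _ (\int[mu]_x ((phi 2)%:E * (\1_(`[1, 2]%classic : set R) x)%:E))).
  rewrite ge0_integralZl//; last by rewrite lee_fin normal_pdf_ge0.
  rewrite integral_indic//= setIT lebesgue_measure_itv/= lte_fin ltr1n.
  rewrite -EFinB -EFinM lte_fin (_ : 2 - 1 = 1 :> R)%R ?mulr1; last lra.
  by rewrite normal_pdfE ?oner_eq0// mulr_gt0 ?normal_peak_gt0 ?oner_eq0 ?expR_gt0.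
  by apply/measurable_EFinP; exact: measurable_indic.
apply: ge0_le_integral => //.
- by move=> x _; rewrite mule_ge0// lee_fin ?normal_pdf_ge0.
- by apply: emeasurable_funM => //; apply/measurable_EFinP; exact: measurable_indic.
- by apply: emeasurable_funM.
move=> x _; rewrite -!EFinM lee_fin indicE mem_setE.
case: (boolP (x \in _)) => [|_]; last by rewrite mulr0 mulr_ge0 ?sqr_ge0 ?normal_pdf_ge0.
rewrite in_itv/= mulr1 => /andP[x1 x2].
rewrite -[leLHS]mul1r ler_pM ?normal_pdf_ge0//; first nra.
rewrite !normal_pdfE ?oner_eq0// ler_wpM2l ?normal_peak_ge0//.
rewrite /normal_fun ler_expR !subr0 expr1n; nra.
Qed.
End Gauss1.

(** * The standard Gaussian measure *)

Section GaussK.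
Context {R : realType}.
Local Notation gam := (@std_normal R).
Local Notation gk := (@std_gauss R).
Local Open Scope ereal_scope.

Lemma ge0_integral_std_gauss0 (f : 0.-tuple R -> \bar R) :
  measurable_fun setT f -> \int[gk 0]_y f y = f [tuple].
Proof. by move=> mf; rewrite integral_dirac// diracT mul1e. Qed.

Lemma ge0_integral_std_gaussS k (f : k.+1.-tuple R -> \bar R) :
  measurable_fun setT f -> (forall y, 0 <= f y) ->
  \int[gk k.+1]_y f y = \int[gam]_x \int[gk k]_y f (cons_pair (x, y)).
Proof.
move=> mf f0; rewrite ge0_integral_distribution//.
rewrite (@fubini_tonelli1 _ _ _ _ _ gam (gk k) (f \o @cons_pair R k))//.
  by apply: (measurableT_comp mf); exact: measurable_cons_pair.
by move=> p; exact: f0.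
Qed.

Lemma measurable_fun_cons_pair d (T : measurableType d) k (u : T -> R)
    (v : T -> k.-tuple R) : measurable_fun setT u -> measurable_fun setT v ->
  measurable_fun setT (fun x => cons_pair (u x, v x)).
Proof. by move=> mu mv; exact: measurable_cons. Qed.

Lemma measurable_integral_std_gauss d (T : measurableType d) k
    (f : T * k.-tuple R -> \bar R) : measurable_fun setT f ->
  (forall p, 0 <= f p) -> measurable_fun setT (fun x => \int[gk k]_y f (x, y)).
Proof. by move=> mf f0; exact: (measurable_fun_fubini_tonelli_F f mf f0). Qed.

Definition comb_tuple k (a b : R) (y y' : k.-tuple R) : k.-tuple R :=
  [tuple (a * tnth y i + b * tnth y' i)%R | i < k].

Lemma measurable_fun_comb_tuple d (T : measurableType d) k (a b : R)
    (u v : T -> k.-tuple R) : measurable_fun setT u -> measurable_fun setT v ->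
  measurable_fun setT (fun x => comb_tuple a b (u x) (v x)).
Proof.
move=> mu mv; apply/measurable_fun_tnthP => i /=.
rewrite (_ : _ \o _ = fun p => a * tnth (u p) i + b * tnth (v p) i)%R; last first.
  by apply/funext => p /=; rewrite tnth_mktuple.
apply: measurable_funD; apply: measurable_funM => //.
  by apply: (measurableT_comp (measurable_tnth i)).
by apply: (measurableT_comp (measurable_tnth i)).
Qed.

Lemma comb_tuple_cons k (a b x x' : R) (y y' : k.-tuple R) :
  comb_tuple a b (cons_pair (x, y)) (cons_pair (x', y')) =
  cons_pair ((a * x + b * x')%R, comb_tuple a b y y').
Proof.
apply: eq_from_tnth => i; rewrite tnth_mktuple.
case: (unliftP ord0 i) => [j ->|->]; first by rewrite !tnthS tnth_mktuple.
by rewrite !tnth0.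
Qed.

(** Induction on the dimension: Tonelli brings the two first coordinates together, the induction
    hypothesis merges the tails and the one-dimensional rule merges the heads. Here
    [comb_tuple c 0 z z] stands for c z. *)
Lemma std_gauss_conv k (f : k.-tuple R -> \bar R) (a b c : R) :
  (0 < b)%R -> (0 <= c)%R -> (a ^+ 2 + b ^+ 2 = c ^+ 2)%R ->
  measurable_fun setT f -> (forall y, 0 <= f y) ->
  \int[gk k]_y \int[gk k]_y' f (comb_tuple a b y y') =
  \int[gk k]_z f (comb_tuple c 0 z z).
Proof.
move=> b0 c0 abc; elim: k f => [f mf f0|k IH f mf f0].
  have t0 (y y' : 0.-tuple R) : y = y' by rewrite (tuple0 y) (tuple0 y').
  have mf' (u : 0.-tuple R -> 0.-tuple R) : measurable_fun setT (fun y => f (u y)).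
    rewrite (_ : (fun y => _) = f)//; apply/funext => y; congr f; exact: t0.
  have -> : (fun y => \int[gk 0]_y' f (comb_tuple a b y y')) = f.
    apply/funext => y; rewrite ge0_integral_std_gauss0//.
    by congr f; exact: t0.
  rewrite !ge0_integral_std_gauss0//.
  by congr f; exact: t0.
have mfc : measurable_fun [set: R * k.-tuple R] (f \o @cons_pair R k).
  by apply: (measurableT_comp mf); exact: measurable_cons_pair.
have mL (a' b' a'' b'' : R) : measurable_fun [set: (R * R) * (k.-tuple R * k.-tuple R)]
    (fun p => f (cons_pair ((a' * p.1.1 + b' * p.1.2)%R, comb_tuple a'' b'' p.2.1 p.2.2))).
  apply: (measurableT_comp mf); apply: measurable_fun_cons_pair.
    apply: measurable_funD; apply: measurable_funM => //.
    - exact: (measurableT_comp measurable_fst).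
    - exact: (measurableT_comp measurable_snd).
  apply: measurable_fun_comb_tuple.
  - exact: (measurableT_comp measurable_fst).
  - exact: (measurableT_comp measurable_snd).
rewrite ge0_integral_std_gaussS; last 2 first.
  apply: (@measurable_integral_std_gauss _ _ k.+1 (fun p => f (comb_tuple a b p.1 p.2)))
      => //.
  by apply: (measurableT_comp mf); exact: measurable_fun_comb_tuple.
  by move=> y; exact: integral_ge0.
transitivity (\int[gam]_x \int[gk k]_y \int[gam]_x' \int[gk k]_y' f (cons_pair ((a * x +
    b * x')%R, comb_tuple a b y y'))).
  apply: eq_integral => x _; apply: eq_integral => y _.
  rewrite ge0_integral_std_gaussS//; last first.
    apply: (measurableT_comp mf); apply: measurable_fun_comb_tuple => //.
  by apply: eq_integral => x' _; apply: eq_integral => y' _; rewrite comb_tuple_cons.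
transitivity (\int[gam]_x \int[gam]_x' \int[gk k]_y \int[gk k]_y' f (cons_pair ((a * x +
    b * x')%R, comb_tuple a b y y'))).
  apply: eq_integral => x _.
  apply: (fubini_tonelli (fun p => \int[gk k]_y' f (cons_pair ((a * x + b * p.2)%R,
      comb_tuple a b p.1 y')))).
    apply: (@measurable_integral_std_gauss _ _ k (fun q => f (cons_pair ((a * x + b *
        q.1.2)%R, comb_tuple a b q.1.1 q.2)))) => //.
    apply: (measurableT_comp mf); apply: measurable_fun_cons_pair.
      apply: measurable_funD => //; apply: measurable_funM => //.
      exact: (measurableT_comp measurable_snd).
    apply: measurable_fun_comb_tuple => //.
    exact: (measurableT_comp measurable_fst).
  by move=> p; exact: integral_ge0.
transitivity (\int[gam]_x \int[gam]_x' \int[gk k]_y f (cons_pair ((a * x + b * x')%R,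
    comb_tuple c 0 y y))).
  apply: eq_integral => x _; apply: eq_integral => x' _.
  apply: (IH (fun y => f (cons_pair ((a * x + b * x')%R, y)))) => //.
  by apply: (measurableT_comp mf); exact: measurable_fun_cons_pair.
rewrite (@std_normal_conv _ (fun x => \int[gk k]_y f (cons_pair (x, comb_tuple c 0 y y)))
    a b c)//; last 2 first.
- apply: (@measurable_integral_std_gauss _ _ k (fun q => f (cons_pair (q.1, comb_tuple c
    0 q.2 q.2)))) => //.
  apply: (measurableT_comp mf); apply: measurable_fun_cons_pair => //.
  exact: measurable_fun_comb_tuple.
- by move=> x; exact: integral_ge0.
rewrite ge0_integral_std_gaussS//; last first.
  by apply: (measurableT_comp mf); exact: measurable_fun_comb_tuple.
apply: eq_integral => x _; apply: eq_integral => y _.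
by rewrite comb_tuple_cons mul0r addr0.
Qed.
End GaussK.

(** * Reflections, marginals and an integrable weight *)

Section GaussK2.
Context {R : realType}.
Local Notation gam := (@std_normal R).
Local Notation gk := (@std_gauss R).
Local Open Scope ereal_scope.

Definition reflect_tuple k (i : 'I_k) (y : k.-tuple R) : k.-tuple R :=
  [tuple if j == i then (- tnth y j)%R else tnth y j | j < k].

Lemma measurable_reflect_tuple k (i : 'I_k) :
  measurable_fun setT (reflect_tuple i).
Proof.
apply/measurable_fun_tnthP => j.
rewrite (_ : _ \o _ = fun y => if j == i then (- tnth y j)%R else tnth y j); last first.
  by apply/funext => y /=; rewrite tnth_mktuple.
case: (j == i); last exact: measurable_tnth.
by apply: measurableT_comp => //; exact: measurable_tnth.
Qed.

(** The symmetry behind the vanishing of first moments and of covariances between distinct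
    coordinates. *)
Lemma std_gauss_reflect k (i : 'I_k) (f : k.-tuple R -> \bar R) :
  measurable_fun setT f -> (forall y, 0 <= f y) ->
  \int[gk k]_y f (reflect_tuple i y) = \int[gk k]_y f y.
Proof.
elim: k i f => [[]//|k IH i f mf f0].
have mfr : measurable_fun setT (fun y => f (reflect_tuple i y)).
  by apply: (measurableT_comp mf); exact: measurable_reflect_tuple.
rewrite ge0_integral_std_gaussS => [|//|y]; last exact: f0.
rewrite [RHS]ge0_integral_std_gaussS => [|//|y]; last exact: f0.
case: (unliftP ord0 i) => [j|] ->.
  apply: eq_integral => x _.
  rewrite -[RHS](IH j (fun y => f (cons_pair (x, y)))) => [|| y]; last exact: f0.
    apply: eq_integral => y _; congr f; apply: eq_from_tnth => l; rewrite tnth_mktuple.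
    case: (unliftP ord0 l) => [l' ->|->]; last by rewrite !tnth0.
    by rewrite !tnthS tnth_mktuple (inj_eq lift_inj).
  by apply: (measurableT_comp mf); exact: measurable_fun_cons_pair.
rewrite -[RHS](@std_normal_opp R (fun x => \int[gk k]_y f (cons_pair (x, y)))) => [|| y].
- apply: eq_integral => x _; apply: eq_integral => y _; congr f; apply: eq_from_tnth => l.
  rewrite tnth_mktuple; case: (unliftP ord0 l) => [l' ->|->]; last by rewrite eqxx !tnth0.
  by rewrite !tnthS.
- apply: (@measurable_integral_std_gauss _ _ _ k (fun q => f (cons_pair (q.1, q.2)))) => //.
  by apply: (measurableT_comp mf); exact: measurable_fun_cons_pair.
- by apply: integral_ge0 => z _; exact: f0.
Qed.

Lemma std_gauss_marginal k (i : 'I_k) (f : R -> \bar R) :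
  measurable_fun setT f -> (forall y, 0 <= f y) ->
  \int[gk k]_y f (tnth y i) = \int[gam]_x f x.
Proof.
move=> mf f0; elim: k i => [[]//|k IH i].
rewrite ge0_integral_std_gaussS => [||y]; last exact: f0.
- case: (unliftP ord0 i) => [j|] ->.
    transitivity (\int[gam]_x \int[gk k]_y f (tnth y j)).
      by apply: eq_integral => x _; apply: eq_integral => y _; rewrite tnthS.
    by rewrite IH integral_cst//= probability_setT mule1.
  apply: eq_integral => x _; transitivity (\int[gk k]_y f x).
    by apply: eq_integral => y _; rewrite tnth0.
  by rewrite integral_cst//= probability_setT mule1.
- by apply: (measurableT_comp mf); exact: measurable_tnth.
Qed.

(** A dominating function for moments: it grows exponentially, and its product form lets the
    integral factor over the coordinates. *)
Definition weight_tuple k (y : k.-tuple R) : R := (\prod_(i < k) expR `|tnth y i|)%R.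

Lemma weight_tuple_ge0 k (y : k.-tuple R) : (0 <= weight_tuple y)%R.
Proof. by apply: prodr_ge0 => i _; exact: expR_ge0. Qed.

Lemma measurable_weight_tuple k : measurable_fun setT (@weight_tuple k).
Proof.
apply: measurable_prod => i _.
apply: measurableT_comp => //; apply: measurableT_comp => //.
exact: measurable_tnth.
Qed.

Lemma std_gauss_weight k : \int[gk k]_y (weight_tuple y)%:E < +oo.
Proof.
have mw k' : measurable_fun setT (EFin \o @weight_tuple k').
  by apply/measurable_EFinP; exact: measurable_weight_tuple.
elim: k => [|k IH].
  by rewrite ge0_integral_std_gauss0 ?ltry//; exact: (mw 0%N).
rewrite ge0_integral_std_gaussS => [||y]; [|exact: mw|by rewrite lee_fin weight_tuple_ge0].
have E x : \int[gk k]_y (weight_tuple (cons_pair (x, y)))%:E =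
    (expR `|x|)%:E * \int[gk k]_y (weight_tuple y)%:E.
  rewrite -ge0_integralZl//; last 2 first.
  - exact: (mw k).
  - by move=> y _; rewrite lee_fin weight_tuple_ge0.
  apply: eq_integral => y _; rewrite /weight_tuple big_ord_recl tnth0 EFinM.
  by congr (_ * (_)%:E); apply: eq_bigr => j _; rewrite tnthS.
under eq_integral do rewrite E.
rewrite ge0_integralZr//; last 2 first.
- by apply/measurable_EFinP; do 2 apply: measurableT_comp => //.
- by apply: integral_ge0 => y _; rewrite lee_fin weight_tuple_ge0.
have e0 : 0 <= \int[gam]_x (expR `|x|)%:E.
  by apply: integral_ge0 => x _; rewrite lee_fin expR_ge0.
by apply: lte_mul_pinfty => //; rewrite ge0_fin_numE// std_normal_expR_abs.
Qed.

End GaussK2.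

(** * Gaussian expectations *)

(** Balls of the sup norm are cubes, that is, finite intersections of conditions on coordinates, and
    an open set is the countable union of the cubes with rational centre and radius 1/(n+1) that it
    contains. This links the topology of rows to the product sigma-algebra of tuples. *)
Lemma measurable_preimage_row_of_tuple (R : realType) k (O : set 'rV[R]_k) :
  open O -> measurable (@row_of_tuple R k @^-1` O).
Proof.
move=> oO.
pose F (p : 'rV[rat]_k * nat) : set (k.-tuple R) :=
  if pselect (ball (map_mx ratr p.1 : 'rV[R]_k) (p.2.+1%:R^-1) `<=` O)
  then \bigcap_(i in [set: 'I_k]) [set y | `|ratr (p.1 0 i) - tnth y i| < p.2.+1%:R^-1]
  else set0.
have -> : @row_of_tuple R k @^-1` O = \bigcup_p F p.
  apply/seteqP; split => [y Oy|y [p _]]; last first.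
    rewrite /F; case: pselect => //= bO yb; apply: bO.
    by split => // i j; rewrite !mxE ord1; exact: yb.
  have /nbhs_ballP[e/= e0 he] : nbhs (row_of_tuple y) O by exact: open_nbhs_nbhs.
  (* Half the radius, since the cube must contain y without being centred there and still lie in the
     e-ball around y. *)
  have [n hn] : exists n, n.+1%:R^-1 < e / 2 :> R.
    have [n _] := near_infty_natSinv_lt (PosNum (divr_gt0 e0 (ltr0Sn R 1))).
    by move=> /(_ n (leqnn n)) hn; exists n.
  have rP (i : 'I_k) : exists q : rat, `|ratr q - tnth y i| < n.+1%:R^-1 :> R.
    have [q] : exists q : rat, ratr q \in `](tnth y i - n.+1%:R^-1), (tnth y i +
        n.+1%:R^-1)[.
      by apply: rat_in_itvoo; rewrite ltrD2l gtrN// invr_gt0.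
    by rewrite in_itv/= => hq; exists q; rewrite distrC ltr_distlC.
  have [q hq] := choice rP.
  exists (\row_i q i, n) => //; rewrite /F; case: pselect => [_ i _ /=|]; first by
      rewrite mxE.
  case=> z [_ hz]; apply: he; split => // i j.
  have := hz ord0 j; rewrite /ball/= ord1 !mxE => h1; have h2 := hq j.
  rewrite -(subrKA (ratr (q j))) (le_lt_trans (ler_normD _ _))// distrC.
  rewrite (splitr e) (ord1 i); apply: ltrD; first exact: lt_trans h2 hn.
  exact: lt_trans h1 hn.
apply: countable_bigcupT_measurable => // p; rewrite /F; case: pselect => [_|_] /=; last
    exact: measurable0.
apply: fin_bigcap_measurable => // i _.
rewrite [X in measurable X](_ : _ = (@tnth k R ^~ i) @^-1` (ball (ratr (p.1 0 i) : R)
    (p.2.+1%:R^-1))) //.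
rewrite -[X in measurable X]setTI; apply: measurable_tnth => //.
exact: measurable_ball.
Qed.

Lemma measurable_row_continuous (R : realType) k (f : 'rV[R]_k -> R) :
  continuous f -> measurable_fun setT (fun y => f (row_of_tuple y)).
Proof.
move=> /continuousP cf; apply: (measurability _ (RGenOpens.measurableE R)).
move=> _ [_ [a [b ->] <-]]; rewrite setTI.
rewrite (_ : _ @^-1` _ = @row_of_tuple R k @^-1` (f @^-1` `]a, b[%classic))//.
by apply: measurable_preimage_row_of_tuple; exact/cf/interval_open.
Qed.

Lemma row_coord_le (R : realType) m (x : 'rV[R]_m) i : `|x 0 i| <= `|x|.
Proof.
rewrite [`|x|]mx_normrE.
exact: (le_bigmax _ (fun ij : 'I_1 * 'I_m => `|x ij.1 ij.2|) (0, i)).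
Qed.

(** * Expectations, moments and the convolution rule *)

Section GaussExp.
Context {R : realType} {k : nat}.
Implicit Types (f g : 'rV[R]_k -> R).
Local Notation row := (@row_of_tuple R k).
Local Notation gk := (@std_gauss R k).

Definition gexp f : R := (\int[gk]_y f (row y))%R.

Definition gint f : Prop := gk.-integrable setT (fun y => (f (row y))%:E).

Definition weight (y : 'rV[R]_k) : R := \prod_(i < k) expR `|y 0 i|.

Lemma weight_ge0 y : 0 <= weight y.
Proof. by apply: prodr_ge0 => i _; exact: expR_ge0. Qed.

Lemma weight_row y : weight (row y) = weight_tuple y.
Proof. by apply: eq_bigr => i _; rewrite mxE. Qed.

Lemma gint_weight : gint weight.
Proof.
rewrite /gint; apply/integrableP; split.
  apply/measurable_EFinP; under eq_fun do rewrite weight_row.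
  exact: measurable_weight_tuple.
under eq_integral do rewrite /= ger0_norm ?weight_ge0// weight_row.
exact: std_gauss_weight.
Qed.

Lemma gintZ c f : gint f -> gint (fun y => c * f y).
Proof. by move=> If; rewrite /gint; under eq_fun do rewrite EFinM; exact: integrableZl. Qed.

Lemma gintD f g : gint f -> gint g -> gint (fun y => f y + g y).
Proof. by move=> If Ig; rewrite /gint; under eq_fun do rewrite EFinD; exact: integrableD.
    Qed.

Lemma gintB f g : gint f -> gint g -> gint (fun y => f y - g y).
Proof. by move=> If Ig; rewrite /gint; under eq_fun do rewrite EFinB; exact: integrableB.
    Qed.

Lemma gint_cst c : gint (fun=> c).
Proof. by apply: finite_measure_integrable_cst. Qed.

Lemma gint_sum I (s : seq I) (f : I -> 'rV[R]_k -> R) :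
  (forall i, gint (f i)) -> gint (fun y => \sum_(i <- s) f i y).
Proof.
move=> If; elim: s => [|i s IH].
  by under eq_fun do rewrite big_nil; exact: gint_cst.
by under eq_fun do rewrite big_cons; exact: gintD.
Qed.

Lemma gint_bound f c : continuous f -> (forall y, `|f y| <= c * weight y) -> gint f.
Proof.
move=> cf fc; apply: (@le_integrable _ _ _ _ _ measurableT _
  (fun y => (c * weight (row y))%:E)) => //.
- by apply/measurable_EFinP; exact: measurable_row_continuous.
- by move=> y _ /=; rewrite lee_fin (le_trans (fc _))// ler_norm.
- exact: (gintZ c gint_weight).
Qed.

Lemma gexp_cst c : gexp (fun=> c) = c.
Proof. by rewrite /gexp Rintegral_cst// [X in fine X]probability_setT/= mulr1. Qed.

Lemma gexpZ c f : gint f -> gexp (fun y => c * f y) = c * gexp f.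
Proof. by move=> If; rewrite /gexp RintegralZl. Qed.

Lemma gexpD f g : gint f -> gint g -> gexp (fun y => f y + g y) = gexp f + gexp g.
Proof. by move=> If Ig; rewrite /gexp RintegralD. Qed.

Lemma gexpB f g : gint f -> gint g -> gexp (fun y => f y - g y) = gexp f - gexp g.
Proof. by move=> If Ig; rewrite /gexp RintegralB. Qed.

Lemma gexp_sum I (s : seq I) (f : I -> 'rV[R]_k -> R) :
  (forall i, gint (f i)) ->
  gexp (fun y => \sum_(i <- s) f i y) = \sum_(i <- s) gexp (f i).
Proof.
move=> If; elim: s => [|i s IH].
  by under eq_fun do rewrite big_nil; rewrite gexp_cst big_nil.
by under eq_fun do rewrite big_cons; rewrite gexpD ?big_cons ?IH//; exact: gint_sum.
Qed.

Lemma gexp_le f g : gint f -> gint g -> (forall y, f y <= g y) -> gexp f <= gexp g.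
Proof. by move=> If Ig fg; apply: le_Rintegral. Qed.

Lemma gexp_norm_le f g : gint f -> gint g -> (forall y, `|f y| <= g y) ->
  `|gexp f| <= gexp g.
Proof.
move=> If Ig fg; rewrite ler_norml; apply/andP; split.
  rewrite -[X in X <= _]mulN1r -gexpZ//; apply: gexp_le => //; first exact: gintZ.
  by move=> y; rewrite mulN1r lerNl (le_trans _ (fg y))// -normrN ler_norm.
by apply: gexp_le => // y; rewrite (le_trans _ (fg y))// ler_norm.
Qed.

Lemma gint_norm f : gint f -> gint (fun y => `|f y|).
Proof. by move=> If; exact: (integrable_abse If). Qed.

(** Reflection invariance is stated for nonnegative integrands, so it is applied to |f| + f, which
    the reflection turns into |f| - f. *)
Lemma gexp_reflect_odd f (i : 'I_k) : continuous f -> gint f ->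
  (forall y : 'rV[R]_k, f (\row_j (if j == i then - y 0 j else y 0 j)) = - f y) ->
  gexp f = 0.
Proof.
move=> cf If fN; have mf := measurable_row_continuous cf.
have If1 := gint_norm If.
have : gexp (fun y => `|f y| + f y) = gexp (fun y => `|f y| - f y).
  rewrite /gexp /Rintegral; congr fine.
  rewrite -(std_gauss_reflect i); last 2 first.
  - apply/measurable_EFinP; apply: measurable_funD => //.
    exact: measurableT_comp.
  - by move=> y; rewrite lee_fin -lerBlDr sub0r -normrN ler_norm.
  apply: eq_integral => y _.
  have -> : row (reflect_tuple i y) = \row_j (if j == i then - row y 0 j else row y 0 j).
    by apply/rowP => j; rewrite !mxE tnth_mktuple.
  by rewrite fN normrN.
rewrite gexpD// gexpB//; lra.
Qed.

(** A coordinate of largest modulus alone contributes e^|y|, the other factors are at least 1, and 1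
    + t <= 6 e^(t/6). Degree 6 is what the expansion of the heat flow requires: a cubic Taylor
    remainder evaluated at increments of size (1 + |y|)^2. *)
Lemma norm_le_weight (y : 'rV[R]_k) : (1 + `|y|) ^+ 6 <= 6 ^+ 6 * weight y.
Proof.
have yw : expR `|y| <= weight y.
  have prod_ge1 (P : pred 'I_k) : 1 <= \prod_(i < k | P i) expR `|y 0 i|.
    by elim/big_ind: _ => // [u v|l _]; [exact: mulr_ege1|rewrite -expR0 ler_expR].
  have [y0|y0] := eqVneq `|y| 0; first by rewrite y0 expR0 prod_ge1.
  have [[i j]/= yE] := mx_norm_neq0 y0.
  rewrite [`|y|]yE (ord1 i) /weight (bigD1 j)//= ler_peMr ?expR_ge0//.
apply: (@le_trans _ _ (6 ^+ 6 * expR `|y|)); last by rewrite ler_wpM2l// exprn_ge0.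
have -> : expR `|y| = expR (`|y| / 6) ^+ 6 by rewrite -expRM_natl; congr expR; field.
rewrite -exprMn lerXn2r ?nnegrE ?addr_ge0// ?mulr_ge0 ?expR_ge0//.
have := expR_ge1Dx (`|y| / 6). have := normr_ge0 y. lra.
Qed.

Lemma gint_poly f c : continuous f -> 0 <= c ->
  (forall y, `|f y| <= c * (1 + `|y|) ^+ 6) -> gint f.
Proof.
move=> cf c0 fc; apply: (@gint_bound _ (c * 6 ^+ 6)) => // y.
by rewrite (le_trans (fc y))// -mulrA ler_wpM2l// norm_le_weight.
Qed.

Lemma gint_coord2 i j : gint (fun y => y 0 i * y 0 j).
Proof.
apply: (@gint_poly _ 1) => //.
  by move=> y; apply: continuousM; exact: coord_continuous.
move=> y; rewrite mul1r normrM.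
have h := row_coord_le y i; have h' := row_coord_le y j.
have y0 := normr_ge0 y.
apply: (@le_trans _ _ ((1 + `|y|) ^+ 2)).
  by rewrite expr2 ler_pM ?normr_ge0//; lra.
by rewrite ler_weXn2l// lerDl.
Qed.

(* The variance of N(0, 1); the proof only needs that it is positive. *)
Definition gvar : R := fine (\int[@std_normal R]_x (x ^+ 2)%:E)%E.

Lemma gexp_coord2 i j : gexp (fun y => y 0 i * y 0 j) = gvar *+ (i == j).
Proof.
case: eqVneq => [<-{j}|ij]; last first.
  apply: (@gexp_reflect_odd _ i); last 2 first.
  - exact: gint_coord2.
  - by move=> y; rewrite !mxE eqxx eq_sym (negPf ij) mulNr.
  by move=> y; apply: continuousM; exact: coord_continuous.
rewrite /gexp /gvar /Rintegral; congr fine.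
rewrite -(std_gauss_marginal i); last 2 first.
- by apply/measurable_EFinP; exact: measurable_funX.
- by move=> y; rewrite lee_fin sqr_ge0.
by apply: eq_integral => y _; rewrite mxE.
Qed.

Lemma gint_coord i : gint (fun y => y 0 i).
Proof.
apply: (@gint_poly _ 1) => //.
  by move=> y; exact: coord_continuous.
move=> y; rewrite mul1r.
have h := row_coord_le y i; have y0 := normr_ge0 y.
apply: (@le_trans _ _ ((1 + `|y|) ^+ 1)); first by rewrite expr1; lra.
by rewrite ler_weXn2l// lerDl.
Qed.

Lemma gexp_coord i : gexp (fun y => y 0 i) = 0.
Proof.
apply: (@gexp_reflect_odd _ i); last 2 first.
- exact: gint_coord.
- by move=> y; rewrite !mxE eqxx.
by move=> y; exact: coord_continuous.
Qed.

(** As [gvar] is a [fine], its integral must also be finite; finiteness is read off the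
    integrability of a squared coordinate in dimension k, whence the condition on k. *)
Lemma gvar_gt0 : (0 < k)%N -> 0 < gvar.
Proof.
move=> k0; pose i := Ordinal k0.
rewrite /gvar fine_gt0// std_normal_sqr_gt0/=.
have := gint_coord2 i i => /integrableP[_].
rewrite -(std_gauss_marginal i); last 2 first.
- by apply/measurable_EFinP; exact: measurable_funX.
- by move=> y; rewrite lee_fin sqr_ge0.
congr (_ < _)%E; apply: eq_integral => y _; rewrite !mxE -expr2.
by rewrite gee0_abs// lee_fin sqr_ge0.
Qed.

Lemma gint_bounded f M : continuous f -> (forall y, `|f y| <= M) -> gint f.
Proof.
move=> cf fM; have M0 : 0 <= M by apply: le_trans (fM 0).
apply: (@gint_poly _ M) => // y; apply: (le_trans (fM y)).
by rewrite ler_peMr// exprn_ege1// lerDl.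
Qed.

Lemma gexp_conv f M (a b c : R) : continuous f -> (forall y, `|f y| <= M) ->
  0 < b -> 0 <= c -> a ^+ 2 + b ^+ 2 = c ^+ 2 ->
  gint (fun y => gexp (fun y' => f (a *: y + b *: y'))) /\
  gexp (fun y => gexp (fun y' => f (a *: y + b *: y'))) = gexp (fun z => f (c *: z)).
Proof.
move=> cf fM b0 c0 abc.
have M0 : 0 <= M by apply: le_trans (fM 0).
have cfl (u : 'rV[R]_k) (d : R) : continuous (fun y : 'rV[R]_k => f (u + d *: y)).
  move=> y; apply: (@continuous_comp _ _ _ (fun y : 'rV[R]_k => u + d *: y)); last exact:
      cf.
  exact: (continuousD (@cst_continuous _ _ u y) (@scaler_continuous _ _ d y)).
pose h y := gexp (fun y' => f (a *: y + b *: y')).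
have If (u : 'rV[R]_k) (d : R) : gint (fun y : 'rV[R]_k => f (u + d *: y)).
  by apply: (@gint_bounded _ M) => //; exact: cfl.
(* Adding the bound M makes the integrand nonnegative, as [std_gauss_conv] demands; M is cancelled
   at the end. *)
pose F (y : k.-tuple R) := ((f (row y) + M)%:E).
have mF : measurable_fun setT F.
  by apply/measurable_EFinP; apply: measurable_funD => //; exact: measurable_row_continuous.
have F0 y : (0 <= F y)%E.
  by rewrite lee_fin; have := fM (row y); rewrite ler_norml => /andP[]; lra.
have rowc a' b' y y' : row (comb_tuple a' b' y y') = a' *: row y + b' *: row y'.
  by apply/rowP => j; rewrite !mxE tnth_mktuple.
have hE y : (\int[gk]_y' F (comb_tuple a b y y') = (h (row y) + M)%:E)%E.
  rewrite /h -[X in _ + X](gexp_cst M) -gexpD//; last exact: gint_cst.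
  rewrite /gexp /Rintegral fineK.
    by apply: eq_integral => y' _; rewrite /F rowc.
  exact: integrable_fin_num (gintD (If (a *: row y) b) (gint_cst M)).
(* Measurability of the inner expectation is inherited from the Tonelli integral of [F]. *)
have mh : measurable_fun setT (fun y => h (row y)).
  rewrite (_ : (fun y => _) = (fun y => (h (row y) + M) - M)); last first.
    by apply/funext => y; rewrite addrK.
  apply: measurable_funB => //; apply/measurable_EFinP.
  rewrite (_ : _ \o _ = fun y => (\int[gk]_y' F (comb_tuple a b y y'))%E); last first.
    by apply/funext => y; rewrite hE.
  apply: (@measurable_integral_std_gauss _ _ _ k (fun p => F (comb_tuple a b p.1 p.2)))
      => //.
  by apply: (measurableT_comp mF); exact: measurable_fun_comb_tuple.
have hM y : `|h y| <= M.
  by rewrite -[leRHS](gexp_cst M); apply: gexp_norm_le => //; exact: gint_cst.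
have Ih : gint h.
  apply: (@le_integrable _ _ _ _ _ measurableT _ (fun=> M%:E)) => //.
  - exact/measurable_EFinP.
  - by move=> y _ /=; rewrite lee_fin (le_trans (hM _))// ler_norm.
  - exact: (gint_cst M).
split => //; apply: (@addIr _ M); rewrite -{1 2}[M](gexp_cst M).
have Ifc : gint (fun z => f (c *: z)).
  by have := If 0 c; under [X in gint X]eq_fun do rewrite add0r.
rewrite -!gexpD//; [|exact: gint_cst|exact: gint_cst].
have := std_gauss_conv b0 c0 abc mF F0.
under eq_integral do rewrite hE.
rewrite /gexp /Rintegral => ->; congr fine; apply: eq_integral => y _.
by rewrite /F rowc scale0r addr0.
Qed.

End GaussExp.

(** * Taylor expansions *)

Section TaylorOneVariable.
Context {R : realType}.
Implicit Types f : R -> R.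

Lemma increment_le f (df : R -> R) (M t : R) : 0 <= t <= 1 ->
  (forall s : R, 0 <= s <= 1 -> is_derive s 1 f (df s)) ->
  (forall s : R, 0 <= s <= 1 -> `|df s| <= M) -> `|f t - f 0| <= M * t.
Proof.
move=> /andP[t0 t1] fd dM.
have [||c] := @MVT_segment R f df 0 t t0.
- move=> x; rewrite in_itv/= => /andP[x0 xt]; apply: fd.
  by rewrite (ltW x0) (le_trans (ltW xt)).
- apply: derivable_within_continuous => x; rewrite in_itv/= => /andP[x0 xt].
  by have [] := fd x; rewrite // x0 (le_trans xt).
rewrite in_itv/= subr0 => /andP[c0 ct] ->.
by rewrite normrM (ger0_norm t0) ler_wpM2r// dM// c0 (le_trans ct).
Qed.

(** Each order applies the previous one to the derivative and drops a factor s <= 1, so the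
    constants are not sharp; in several variables these bounds are applied at t = 1. *)
Lemma taylor1_le f (df ddf : R -> R) (M t : R) : 0 <= t <= 1 ->
  (forall s : R, 0 <= s <= 1 -> is_derive s 1 f (df s)) ->
  (forall s : R, 0 <= s <= 1 -> is_derive s 1 df (ddf s)) ->
  (forall s : R, 0 <= s <= 1 -> `|ddf s| <= M) -> `|f t - f 0 - t * df 0| <= M * t.
Proof.
move=> t01 fd dfd dM.
have M0 : 0 <= M by apply: le_trans (dM 0 _); rewrite ?lexx ?ler01.
pose g s := f s - s * df 0.
have := @increment_le g (fun s => df s - df 0) M t t01.
rewrite /g mul0r subr0 -addrA (addrC (- _)) addrA; apply.
- move=> s s01; have fs := fd s s01.
  by apply: is_derive_eq; rewrite /GRing.scale/=; ring.
- move=> s s01; rewrite (le_trans (increment_le s01 dfd dM))//.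
  by rewrite ler_piMr//; case/andP: s01.
Qed.

Lemma taylor2_le f (df ddf dddf : R -> R) (M t : R) : 0 <= t <= 1 ->
  (forall s : R, 0 <= s <= 1 -> is_derive s 1 f (df s)) ->
  (forall s : R, 0 <= s <= 1 -> is_derive s 1 df (ddf s)) ->
  (forall s : R, 0 <= s <= 1 -> is_derive s 1 ddf (dddf s)) ->
  (forall s : R, 0 <= s <= 1 -> `|dddf s| <= M) ->
  `|f t - f 0 - t * df 0 - t ^+ 2 / 2 * ddf 0| <= M * t.
Proof.
move=> t01 fd dfd ddfd dM.
have M0 : 0 <= M by apply: le_trans (dM 0 _); rewrite ?lexx ?ler01.
pose g s := f s - s * df 0 - s ^+ 2 / 2 * ddf 0.
have := @increment_le g (fun s => df s - df 0 - s * ddf 0) M t t01.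
have -> : g t - g 0 = f t - f 0 - t * df 0 - t ^+ 2 / 2 * ddf 0.
  by rewrite /g; ring.
apply.
- move=> s s01; have fs := fd s s01.
  by rewrite /g; apply: is_derive_eq; rewrite /GRing.scale/=; field.
- move=> s s01; rewrite (le_trans (taylor1_le s01 dfd ddfd dM))//.
  by rewrite ler_piMr//; case/andP: s01.
Qed.
End TaylorOneVariable.

(** * Several variables: derivatives along segments and bounds on compact sets *)

Section Partials.
Context {R : realType} {m : nat}.
Implicit Types (f : 'rV[R]_m -> R) (x h : 'rV[R]_m) (U : set 'rV[R]_m).

Lemma derive_partial f x h : differentiable f x ->
  'D_h f x = \sum_i h 0 i * partial i f x.
Proof.
move=> df; rewrite deriveE// {1}(row_sum_delta h) linear_sum/=.
by apply: eq_bigr => i _; rewrite linearZ/= /partial deriveE.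
Qed.

Lemma is_derive_line f x h (s : R) : differentiable f (x + s *: h) ->
  is_derive s 1 (fun s : R => f (x + s *: h)) (\sum_i h 0 i * partial i f (x + s *: h)).
Proof.
move=> df; rewrite -derive_partial//.
have E : (fun t : R => t^-1 *: (((fun s : R => f (x + s *: h)) \o shift s) (t *: 1) - f
    (x + s *: h)))
  = (fun t : R => t^-1 *: ((f \o shift (x + s *: h)) (t *: h) - f (x + s *: h))).
  apply/funext => t /=; congr (_ *: (f _ - _)).
  by rewrite scalerDl [in LHS]/GRing.scale/= mulr1 addrCA.
have dd : derivable f (x + s *: h) h by exact: diff_derivable.
by apply: DeriveDef; [rewrite /derivable E|rewrite /derive E].
Qed.

Lemma smooth_on_partial U f i : smooth_on U f -> smooth_on U (partial i f).
Proof.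
by move=> sf s x Ux; have := sf (rcons s i) x Ux; rewrite -cats1 foldr_cat.
Qed.

Lemma smooth_on_differentiable U f x : smooth_on U f -> U x -> differentiable f x.
Proof. by move=> sf Ux; exact: (sf [::]). Qed.

Lemma smooth_on_continuous U f x : smooth_on U f -> U x -> {for x, continuous f}.
Proof.
by move=> sf Ux; apply: differentiable_continuous; exact: smooth_on_differentiable Ux.
Qed.

Lemma sum_mul_le h (a : 'I_m -> R) M : (forall i, `|a i| <= M) ->
  `|\sum_i h 0 i * a i| <= m%:R * M * `|h|.
Proof.
move=> aM; apply: (le_trans (ler_norm_sum _ _ _)).
apply: (@le_trans _ _ (\sum_(i < m) M * `|h|)).
  by apply: ler_sum => i _; rewrite normrM mulrC ler_pM// row_coord_le.
by rewrite sumr_const card_ord -mulrA mulr_natl.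
Qed.

Lemma smooth_increment_le U f x h M : smooth_on U f ->
  (forall s : R, 0 <= s <= 1 -> U (x + s *: h)) ->
  (forall s : R, 0 <= s <= 1 -> forall i, `|partial i f (x + s *: h)| <= M) ->
  `|f (x + h) - f x| <= m%:R * M * `|h|.
Proof.
move=> sf Us pM.
have := @increment_le R (fun s => f (x + s *: h)) _ (m%:R * M * `|h|) 1 _
  (fun s s01 => is_derive_line (smooth_on_differentiable sf (Us s s01))).
rewrite scale1r scale0r addr0 mulr1; apply; first by rewrite lexx ler01.
by move=> s s01; apply: sum_mul_le => i; exact: pM.
Qed.

Lemma is_derive_line2 U f x h (s : R) : smooth_on U f -> U (x + s *: h) ->
  is_derive s 1 (fun s : R => \sum_i h 0 i * partial i f (x + s *: h))
    (\sum_j \sum_i h 0 j * h 0 i * partial i (partial j f) (x + s *: h)).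
Proof.
move=> sf Us.
rewrite (_ : (fun s : R => _) = \sum_i (h 0 i \*: (fun s : R => partial i f (x + s *:
    h)))); last first.
  by apply/funext => t; rewrite fct_sumE.
apply: is_derive_eq.
  apply: is_derive_sum => i; apply: is_deriveZ; apply: is_derive_line.
  exact: (smooth_on_differentiable (smooth_on_partial i sf) Us).
apply: eq_bigr => j _; rewrite [LHS]/GRing.scale/= mulr_sumr.
by apply: eq_bigr => i _; rewrite mulrA.
Qed.

Lemma is_derive_line3 U f x h (s : R) : smooth_on U f -> U (x + s *: h) ->
  is_derive s 1
    (fun s : R => \sum_j \sum_i h 0 j * h 0 i * partial i (partial j f) (x + s *: h))
    (\sum_j h 0 j * \sum_l \sum_i h 0 l * h 0 i * partial i (partial l (partial j f)) (x
        + s *: h)).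
Proof.
move=> sf Us.
rewrite (_ : (fun s : R => _) = \sum_j (h 0 j \*: (fun s : R =>
    \sum_i h 0 i * partial i (partial j f) (x + s *: h)))); last first.
  apply/funext => t; rewrite fct_sumE; apply: eq_bigr => j _.
  by rewrite /= [RHS]/GRing.scale/= mulr_sumr; apply: eq_bigr => i _; rewrite mulrA.
apply: is_derive_eq.
  apply: is_derive_sum => j; apply: is_deriveZ.
  exact: (is_derive_line2 (smooth_on_partial j sf) Us).
by apply: eq_bigr.
Qed.

Lemma sum2_mul_le h (a : 'I_m -> 'I_m -> R) M : (forall i j, `|a i j| <= M) ->
  `|\sum_j \sum_i h 0 j * h 0 i * a i j| <= m%:R ^+ 2 * M * `|h| ^+ 2.
Proof.
move=> aM.
under eq_bigr do under eq_bigr do rewrite -mulrA.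
under eq_bigr do rewrite -mulr_sumr.
have -> : m%:R ^+ 2 * M * `|h| ^+ 2 = m%:R * (m%:R * M * `|h|) * `|h| by ring.
by apply: sum_mul_le => j; exact: sum_mul_le.
Qed.

Lemma smooth_taylor1_le U f x h M : smooth_on U f ->
  (forall s : R, 0 <= s <= 1 -> U (x + s *: h)) ->
  (forall s : R, 0 <= s <= 1 ->
    forall i j, `|partial i (partial j f) (x + s *: h)| <= M) ->
  `|f (x + h) - f x - \sum_i h 0 i * partial i f x| <= m%:R ^+ 2 * M * `|h| ^+ 2.
Proof.
move=> sf Us pM.
have := @taylor1_le R (fun s => f (x + s *: h)) _ _ (m%:R ^+ 2 * M * `|h| ^+ 2) 1 _
  (fun s s01 => is_derive_line (smooth_on_differentiable sf (Us s s01)))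
  (fun s s01 => is_derive_line2 sf (Us s s01)).
rewrite scale1r scale0r addr0 mulr1 mul1r; apply; first by rewrite lexx ler01.
by move=> s s01; apply: sum2_mul_le => i j; exact: pM.
Qed.

Lemma smooth_taylor2_le U f x h M : smooth_on U f ->
  (forall s : R, 0 <= s <= 1 -> U (x + s *: h)) ->
  (forall s : R, 0 <= s <= 1 ->
    forall i j l, `|partial i (partial j (partial l f)) (x + s *: h)| <= M) ->
  `|f (x + h) - f x - \sum_i h 0 i * partial i f x -
    2^-1 * \sum_j \sum_i h 0 j * h 0 i * partial i (partial j f) x|
  <= m%:R ^+ 3 * M * `|h| ^+ 3.
Proof.
move=> sf Us pM.
have := @taylor2_le R (fun s => f (x + s *: h)) _ _ _ (m%:R ^+ 3 * M * `|h| ^+ 3) 1 _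
  (fun s s01 => is_derive_line (smooth_on_differentiable sf (Us s s01)))
  (fun s s01 => is_derive_line2 sf (Us s s01))
  (fun s s01 => is_derive_line3 sf (Us s s01)).
rewrite scale1r scale0r addr0 mulr1 expr1n !mul1r; apply; first by rewrite lexx ler01.
move=> s s01.
have -> : m%:R ^+ 3 * M * `|h| ^+ 3 = m%:R * (m%:R ^+ 2 * M * `|h| ^+ 2) * `|h| by ring.
by apply: sum_mul_le => j; apply: sum2_mul_le => i l; exact: pM.
Qed.

Lemma compact_continuous_bounded (K : set 'rV[R]_m) f : compact K ->
  (forall x, K x -> {for x, continuous f}) ->
  exists M, forall x, K x -> `|f x| <= M.
Proof.
move=> cK cf; have [K0|/set0P K0] := eqVneq K set0.
  by exists 0 => x; rewrite K0.
have [|c _ hc] := @compact_EVT_max _ R (fun x => `|f x|) K K0 cK.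
  apply: continuous_in_subspaceT => x /set_mem Kx.
  by apply: (@continuous_comp _ _ _ f (fun y => `|y|)); [exact: cf|exact: norm_continuous].
by exists `|f c| => x Kx; apply: hc; exact/mem_set.
Qed.

Lemma compact_continuous_bounded_family (I : finType) (K : set 'rV[R]_m)
    (f : I -> 'rV[R]_m -> R) : compact K ->
  (forall i x, K x -> {for x, continuous (f i)}) ->
  exists2 M, 0 <= M & forall i x, K x -> `|f i x| <= M.
Proof.
move=> cK cf.
have [M hM] := choice (fun i => compact_continuous_bounded cK (cf i)).
exists (\sum_i `|M i|) => [|i x Kx]; first exact: sumr_ge0.
rewrite (le_trans (hM i x Kx))// (le_trans (ler_norm _))// (bigD1 i)//= lerDl.
exact: sumr_ge0.
Qed.

Lemma partial_vanish (K : set 'rV[R]_m) f i : closed K ->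
  (forall x, ~ K x -> f x = 0) -> forall x, ~ K x -> partial i f x = 0.
Proof.
move=> cK f0 x nKx; rewrite /partial -(@derive_cst _ _ _ (0 : R) x (delta_mx 0 i)).
have nx : \near x, f x = (cst 0 : 'rV[R]_m -> R) x.
  have oK : open (~` K) by rewrite openC.
  by apply: filterS (open_nbhs_nbhs (conj oK nKx)) => y /f0.
exact: near_eq_derive nx.
Qed.
End Partials.

(** * Bounds preserved by the heat semigroup *)

Lemma continuous_of_increment (R : realType) (V W : normedModType R) (f : V -> W)
    (c : R) : (forall x h, `|f (x + h) - f x| <= c * (`|h| + `|h| ^+ 2)) ->
  continuous f.
Proof.
move=> fc x; apply/cvgrPdist_le => e e0.
pose c' := `|c| + 1; have c'0 : 0 < c' by rewrite ltr_wpDl.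
pose d := Num.min 1 (e / (2 * c')).
have d0 : 0 < d by rewrite lt_min ltr01 divr_gt0// mulr_gt0.
near=> y.
have yd : `|y - x| <= d.
  near: y; apply/nbhs_ballP; exists d => //= y.
  by rewrite -ball_normE/= distrC => /ltW.
have yE : x + (y - x) = y by rewrite addrCA subrr addr0.
have := fc x (y - x); rewrite yE distrC => /le_trans; apply.
have h0 := normr_ge0 (y - x).
move: yd; rewrite le_min => /andP[y1 ye].
apply: (@le_trans _ _ (c' * (2 * `|y - x|))).
  apply: (@le_trans _ _ (c' * (`|y - x| + `|y - x| ^+ 2))).
    by rewrite ler_wpM2r ?addr_ge0 ?exprn_ge0// (le_trans (ler_norm _))// lerDl.
  rewrite ler_wpM2l ?(ltW c'0)// mulrDl mul1r lerD2l expr2.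
  by rewrite ler_piMr.
move: ye; rewrite ler_pdivlMr ?mulr_gt0//.
by rewrite (_ : `|y - x| * (2 * c') = c' * (2 * `|y - x|)); last by ring.
Unshelve. all: by end_near.
Qed.

Lemma mulmx_norm_le (R : realType) m n (A : 'M[R]_(m, n)) :
  exists2 c, 0 <= c & forall h : 'rV[R]_m, `|h *m A| <= c * `|h|.
Proof.
exists (\sum_j \sum_i `|A i j|); first by do 2 (apply: sumr_ge0 => ? _).
move=> h; rewrite [`|_ *m _|]mx_normrE.
apply/bigmax_leP; split => [|[i j] _ /=].
  by rewrite mulr_ge0//; do 2 (apply: sumr_ge0 => ? _).
rewrite mxE (ord1 i) (le_trans (ler_norm_sum _ _ _))//.
apply: (@le_trans _ _ ((\sum_i `|A i j|) * `|h|)).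
  rewrite mulr_suml ler_sum// => l _; rewrite normrM mulrC ler_wpM2l// row_coord_le//.
rewrite ler_wpM2r// [leRHS](bigD1 j)//= lerDl.
by do 2 (apply: sumr_ge0 => ? _).
Qed.

Lemma mulmx_trmx_sum (R : realType) m (u w : 'rV[R]_m) :
  (u *m w^T) 0 0 = \sum_l u 0 l * w 0 l.
Proof. by rewrite mxE; apply: eq_bigr => l _; rewrite mxE. Qed.

Section Tame.
Context {R : realType} {n k : nat} {k_ : 'I_n -> nat}.
Variables (A : forall j, 'M[R]_(k, k_ j)) (lo hi : 'I_n -> R).

(* Here g j x is the gradient of the j-th component at x A_j. These bounds are
   stable under averaging, so [heat_vec] preserves them with the same M. *)
Definition tame (M : R) (v : 'rV[R]_k -> 'rV[R]_n)
    (g : forall j, 'rV[R]_k -> 'rV[R]_(k_ j)) : Prop :=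
  [/\ forall x j, lo j <= v x 0 j <= hi j,
      forall x j l, `|g j x 0 l| <= M,
      forall x h j l, `|g j (x + h) 0 l - g j x 0 l| <= M * `|h| &
      forall x h j,
        `|v (x + h) 0 j - v x 0 j - (h *m A j *m (g j x)^T) 0 0| <= M * `|h| ^+ 2].

Lemma smooth_compact_bounded m (f : 'rV[R]_m -> R) :
  smooth_on setT f -> compactly_supported f ->
  exists2 M, 0 <= M & [/\ forall y i, `|partial i f y| <= M &
     forall y i j, `|partial i (partial j f) y| <= M].
Proof.
move=> sf cf0; pose K := closure [set x | f x != 0].
have cf : compact K by [].
have clK : closed K by exact: closed_closure.
have f0 x : ~ K x -> f x = 0.
  by move=> nK; apply: contrapT => fx; apply: nK; apply: subset_closure; apply/eqP.
have p0 i x : ~ K x -> partial i f x = 0 by exact: partial_vanish.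
have pp0 i j x : ~ K x -> partial i (partial j f) x = 0.
  by apply: partial_vanish => //; exact: p0.
have [M1 M10 hM1] := compact_continuous_bounded_family cf
  (fun i x _ => smooth_on_continuous (smooth_on_partial i sf) (I : setT x)).
have [M2 M20 hM2] := compact_continuous_bounded_family cf
  (fun (ij : 'I_m * 'I_m) x _ => smooth_on_continuous
    (smooth_on_partial ij.1 (smooth_on_partial ij.2 sf)) (I : setT x)).
exists (M1 + M2); first exact: addr_ge0.
split => [y i|y i j]; have [Ky|nKy] := pselect (K y).
- by rewrite (le_trans (hM1 i y Ky))// lerDl.
- by rewrite p0// normr0 addr_ge0.
- by rewrite (le_trans (hM2 (i, j) y Ky))// lerDr.
- by rewrite pp0// normr0 addr_ge0.
Qed.

Definition grad_joint (u : forall j, 'rV[R]_(k_ j) -> R) j (x : 'rV[R]_k) : 'rV[R]_(k_ j) :=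
  \row_l partial l (u j) (x *m A j).

Lemma tame_joint (u : forall j, 'rV[R]_(k_ j) -> R) :
  (forall j, smooth_on setT (u j) /\ compactly_supported (u j)) ->
  (forall x j, lo j <= u j (x *m A j) <= hi j) ->
  exists2 M, 0 <= M & tame M (joint A u) (grad_joint u).
Proof.
move=> su lohi.
have /choice[M hM] : forall j, exists M, 0 <= M /\
    [/\ forall y i, `|partial i (u j) y| <= M &
        forall y i i', `|partial i (partial i' (u j)) y| <= M].
  move=> j; have [sj cj] := su j.
  by have [M M0 h] := smooth_compact_bounded sj cj; exists M.
have /choice[c hc] : forall j, exists c, 0 <= c /\
    forall h : 'rV[R]_k, `|h *m A j| <= c * `|h|.
  by move=> j; have [c c0 h] := mulmx_norm_le (A j); exists c.
(* One summand per bound of [tame]: the gradient, its Lipschitz constant, the quadratic remainder.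
   The powers of [c j] come from |h A_j| <= c_j |h|. *)
pose Mj j := M j + (k_ j)%:R * M j * c j + (k_ j)%:R ^+ 2 * M j * c j ^+ 2.
have M0 j : 0 <= M j by case: (hM j).
have c0 j : 0 <= c j by case: (hc j).
have h1 j : 0 <= (k_ j)%:R * M j * c j by rewrite !mulr_ge0.
have h2 j : 0 <= (k_ j)%:R ^+ 2 * M j * c j ^+ 2 by rewrite !mulr_ge0// exprn_ge0.
have Mj0 j : 0 <= Mj j by rewrite !addr_ge0.
have le_sum j : Mj j <= \sum_i Mj i by rewrite [leRHS](bigD1 j)//= lerDl sumr_ge0.
exists (\sum_j Mj j); first exact: sumr_ge0.
split.
- by move=> x j; rewrite mxE.
- move=> x j l; rewrite mxE; apply: le_trans (le_sum j).
  case: (hM j) => _ [h _]; rewrite (le_trans (h _ _))// /Mj -addrA lerDl.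
  exact: addr_ge0.
- move=> x h j l; rewrite !mxE mulmxDl.
  case: (hM j) => _ [_ hpp].
  apply: (le_trans (smooth_increment_le (smooth_on_partial l (su j).1) _ (M := M j) _))
      => //.
  apply: (@le_trans _ _ (((k_ j)%:R * M j * c j) * `|h|)).
    by rewrite -[leRHS]mulrA ler_wpM2l ?mulr_ge0//; case: (hc j).
  rewrite ler_wpM2r//; apply: le_trans (le_sum j).
  by rewrite /Mj addrAC lerDr addr_ge0.
- move=> x h j; rewrite mulmx_trmx_sum.
  have -> : \sum_l (h *m A j) 0 l * grad_joint u j x 0 l =
      \sum_l (h *m A j) 0 l * partial l (u j) (x *m A j).
    by apply: eq_bigr => l _; rewrite [grad_joint _ _ _ _ _]mxE.
  rewrite 2![joint _ _ _ _ _]mxE mulmxDl.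
  case: (hM j) => _ [_ hpp].
  apply: (le_trans (smooth_taylor1_le (su j).1 _ (M := M j) _)) => //.
  apply: (@le_trans _ _ (((k_ j)%:R ^+ 2 * M j * c j ^+ 2) * `|h| ^+ 2)).
    rewrite -[leRHS]mulrA -exprMn ler_wpM2l ?mulr_ge0 ?exprn_ge0// lerXn2r ?nnegrE
        ?mulr_ge0//.
    by case: (hc j).
  rewrite ler_wpM2r ?exprn_ge0//; apply: le_trans (le_sum j).
  by rewrite /Mj lerDr addr_ge0.
Qed.

End Tame.

Lemma continuous_mulmx (R : realType) m n (A : 'M[R]_(m, n)) :
  continuous (fun y : 'rV[R]_m => y *m A).
Proof.
have [c c0 hc] := mulmx_norm_le A.
apply: (@continuous_of_increment _ _ _ _ c) => x h.
rewrite mulmxDl addrAC subrr add0r (le_trans (hc h))// ler_wpM2l// lerDl.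
by rewrite exprn_ge0.
Qed.

(** * The semigroup law *)

Section Heat.
Context {R : realType} {k : nat}.
Variable C : 'M[R]_k.
Implicit Types (f : 'rV[R]_k -> R) (x y : 'rV[R]_k).
Local Notation S := (sqrtmx C).

Lemma heatE t f x :
  heat C t f x = gexp (fun y => f (x + Num.sqrt (2 * t) *: (y *m S))).
Proof. by []. Qed.

Lemma continuous_heat_arg f x c : continuous f ->
  continuous (fun y => f (x + c *: (y *m S))).
Proof.
move=> cf y; apply: (@continuous_comp _ _ _ (fun y => x + c *: (y *m S)) f); last exact: cf.
apply: (continuousD (@cst_continuous _ _ x y)).
exact: (continuous_comp (@continuous_mulmx _ _ _ S y) (@scaler_continuous _ _ c _)).
Qed.

Lemma gint_heat f M x t : continuous f -> (forall y, `|f y| <= M) ->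
  gint (fun y => f (x + Num.sqrt (2 * t) *: (y *m S))).
Proof.
by move=> cf fM; apply: (@gint_bounded _ _ _ M) => //; exact: continuous_heat_arg.
Qed.

Lemma heat0 f x : heat C 0 f x = f x.
Proof.
rewrite heatE mulr0 sqrtr0; under eq_fun do rewrite scale0r addr0.
by rewrite gexp_cst.
Qed.

(** The convolution rule with squares 2 s, 2 t and 2 (s + t); it needs a positive second
    coefficient, so t = 0 is treated apart. The integrability conjunct allows inequalities to be
    averaged later. *)
Lemma heat_heat f M s t x : continuous f -> (forall y, `|f y| <= M) ->
  0 <= s -> 0 <= t ->
  gint (fun y => heat C t f (x + Num.sqrt (2 * s) *: (y *m S))) /\
  heat C s (heat C t f) x = heat C (s + t) f x.
Proof.
move=> cf fM s0; rewrite le_eqVlt => /predU1P[<-|t0].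
  have -> : heat C 0 f = f by apply/funext => y; rewrite heat0.
  by rewrite addr0; split => //; exact: gint_heat fM.
have cf' : continuous (fun y => f (x + y *m S)).
  by have := @continuous_heat_arg f x 1 cf; under [X in continuous X -> _]eq_fun do
      rewrite scale1r.
have [|||Ih hE] := @gexp_conv R k (fun y => f (x + y *m S)) M (Num.sqrt (2 * s))
  (Num.sqrt (2 * t)) (Num.sqrt (2 * (s + t))) cf' (fun y => fM _).
- by rewrite sqrtr_gt0 mulr_gt0.
- exact: sqrtr_ge0.
- by rewrite !sqr_sqrtr ?mulr_ge0 ?addr_ge0 ?(ltW t0)// mulrDr.
- have E y : gexp (fun y' => f (x + (Num.sqrt (2 * s) *: y + Num.sqrt (2 * t) *: y') *m
    S)) =
      heat C t f (x + Num.sqrt (2 * s) *: (y *m S)).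
    rewrite heatE; congr gexp; apply/funext => y'.
    by rewrite mulmxDl -!scalemxAl addrA.
  have E' : (fun y => gexp (fun y' => f (x + (Num.sqrt (2 * s) *: y + Num.sqrt (2 * t) *:
      y') *m S)))
     = (fun y => heat C t f (x + Num.sqrt (2 * s) *: (y *m S))) by apply/funext.
  rewrite E' in Ih hE; split => //; rewrite heatE hE heatE; congr gexp; apply/funext => y.
  by rewrite -scalemxAl.
Qed.

Lemma heat_bound f M t x : continuous f -> (forall y, `|f y| <= M) -> `|heat C t f x| <= M.
Proof.
move=> cf fM; rewrite heatE -[leRHS](@gexp_cst R k); apply: gexp_norm_le => //.
- exact: gint_heat fM.
- exact: gint_cst.
Qed.

End Heat.

Lemma row_norm_le (R : realType) m (z : 'rV[R]_m) c : 0 <= c ->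
  (forall j, `|z 0 j| <= c) -> `|z| <= c.
Proof.
move=> c0 zc; rewrite [`|z|]mx_normrE; apply/bigmax_leP; split => // -[i j] _ /=.
by rewrite (ord1 i).
Qed.

Lemma linear_form_le (R : realType) n k (k_ : 'I_n -> nat)
    (A : forall j, 'M[R]_(k, k_ j)) M : 0 <= M ->
  exists2 c, 0 <= c & forall j (w : 'rV[R]_(k_ j)), (forall l, `|w 0 l| <= M) ->
    forall h : 'rV[R]_k, `|(h *m A j *m w^T) 0 0| <= c * `|h|.
Proof.
move=> M0.
have /choice[c hc] : forall j, exists c, 0 <= c /\
    forall h : 'rV[R]_k, `|h *m A j| <= c * `|h|.
  by move=> j; have [c c0 h] := mulmx_norm_le (A j); exists c.
have c0 j : 0 <= c j by case: (hc j).
exists (\sum_j (k_ j)%:R * M * c j); first by apply: sumr_ge0 => j _; rewrite !mulr_ge0.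
move=> j w wM h; rewrite mulmx_trmx_sum (le_trans (sum_mul_le _ wM))//.
apply: (@le_trans _ _ ((k_ j)%:R * M * c j * `|h|)).
  by rewrite -[leRHS]mulrA ler_wpM2l ?mulr_ge0//; case: (hc j).
by rewrite ler_wpM2r// [leRHS](bigD1 j)//= lerDl sumr_ge0// => i _; rewrite !mulr_ge0.
Qed.

Section TameHeat.
Context {R : realType} {n k : nat} {k_ : 'I_n -> nat}.
Variables (A : forall j, 'M[R]_(k, k_ j)) (lo hi : 'I_n -> R) (C : 'M[R]_k).
Variables (M : R) (v : 'rV[R]_k -> 'rV[R]_n) (g : forall j, 'rV[R]_k -> 'rV[R]_(k_ j)).
Hypotheses (M0 : 0 <= M) (tv : tame A lo hi M v g).

(** The purpose of the Lipschitz clause of [tame]: continuous gradients are measurable and can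
    themselves be averaged. *)
Lemma tame_grad_continuous j l : continuous (fun x => g j x 0 l).
Proof.
have [_ _ h _] := tv; apply: (@continuous_of_increment _ _ _ _ M) => x y.
by rewrite (le_trans (h _ _ _ _))// ler_wpM2l// lerDl exprn_ge0.
Qed.

Lemma tame_continuous : continuous v.
Proof.
have [_ gM _ h] := tv; have [c c0 hc] := linear_form_le A M0.
apply: (@continuous_of_increment _ _ _ _ (M + c)) => x y.
have y0 := normr_ge0 y.
apply: row_norm_le => [|j]; first by rewrite mulr_ge0 ?addr_ge0// exprn_ge0.
rewrite mxE [X in _ + X]mxE.
have := ler_normD (v (x + y) 0 j - v x 0 j - (y *m A j *m (g j x)^T) 0 0) ((y *m A j *m
    (g j x)^T) 0 0).
rewrite subrK => /le_trans; apply.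
apply: (le_trans (lerD (h _ _ _) (hc j (g j x) (gM x j) y))).
have := mulr_ge0 M0 y0; have := mulr_ge0 c0 (exprn_ge0 2 y0).
lra.
Qed.

Lemma tame_coord_continuous j : continuous (fun x => v x 0 j).
Proof.
by move=> x; apply: (@continuous_comp _ _ _ v (fun z : 'rV[R]_n => z 0 j));
  [exact: tame_continuous|exact: coord_continuous].
Qed.

Lemma tame_bounded j : exists M', forall x, `|v x 0 j| <= M'.
Proof.
have [h _ _ _] := tv; exists (`|lo j| + `|hi j|) => x.
have /andP[h1 h2] := h x j; rewrite ler_norml; apply/andP; split.
  apply: le_trans h1; rewrite opprD.
  have := ler_norm (- lo j); rewrite normrN; have := normr_ge0 (hi j); lra.
apply: (le_trans h2); have := ler_norm (hi j); have := normr_ge0 (lo j); lra.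
Qed.

(** Each clause bounds an expression linear in the values of [v] and [g] at translated points, and
    translations commute with averaging, so the bound passes under the expectation. *)
Lemma tame_heat s :
  tame A lo hi M (heat_vec C s v) (fun j x => \row_l heat C s (fun y => g j y 0 l) x).
Proof.
have [h1 h2 h3 h4] := tv.
have Iv x j : gint (fun y => v (x + Num.sqrt (2 * s) *: (y *m sqrtmx C)) 0 j).
  have [M' hM'] := tame_bounded j.
  by apply: (@gint_heat _ _ C (fun x => v x 0 j) M'); [exact: tame_coord_continuous|].
have Ig x j l : gint (fun y => g j (x + Num.sqrt (2 * s) *: (y *m sqrtmx C)) 0 l).
  by apply: (@gint_heat _ _ C (fun x => g j x 0 l) M); [exact: tame_grad_continuous|].
split.
- move=> x j; rewrite mxE heatE; apply/andP; split.
    rewrite -[leLHS](@gexp_cst R k); apply: gexp_le => //; first exact: gint_cst.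
    by move=> y; case/andP: (h1 (x + Num.sqrt (2 * s) *: (y *m sqrtmx C)) j).
  rewrite -[leRHS](@gexp_cst R k); apply: gexp_le => //; first exact: gint_cst.
  by move=> y; case/andP: (h1 (x + Num.sqrt (2 * s) *: (y *m sqrtmx C)) j).
- move=> x j l; rewrite mxE; apply: heat_bound => //.
  exact: tame_grad_continuous.
- move=> x h j l; rewrite !mxE !heatE -gexpB//.
  rewrite -[leRHS](@gexp_cst R k); apply: gexp_norm_le; [exact: gintB|exact: gint_cst|].
  by move=> y; rewrite addrAC.
- move=> x h j; rewrite mulmx_trmx_sum 2![heat_vec _ _ _ _ _ _]mxE !heatE.
  under eq_bigr do rewrite [X in _ * X]mxE heatE -gexpZ//.
  rewrite -gexp_sum; last by move=> l; exact: gintZ.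
  rewrite -gexpB// -gexpB//; last 2 first.
  - exact: gintB.
  - by apply: gint_sum => l; exact: gintZ.
  rewrite -[leRHS](@gexp_cst R k); apply: gexp_norm_le; [|exact: gint_cst|].
    by apply: gintB; [exact: gintB|apply: gint_sum => l; exact: gintZ].
  by move=> y; rewrite -mulmx_trmx_sum (addrAC x h); exact: h4.
Qed.

End TameHeat.

(** * Second-order expansion of the heat flow *)

Section GaussForms.
Context {R : realType} {k : nat}.
Implicit Types (p q y : 'rV[R]_k).

Lemma gint_linear p : gint (fun y => (y *m p^T) 0 0).
Proof.
under eq_fun do rewrite mulmx_trmx_sum.
apply: gint_sum => l; under eq_fun do rewrite mulrC.
by apply: gintZ; exact: gint_coord.
Qed.

Lemma gexp_linear p : gexp (fun y => (y *m p^T) 0 0) = 0.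
Proof.
rewrite (_ : (fun y => _) = fun y => \sum_l p 0 l * y 0 l); last first.
  by apply/funext => y; rewrite mulmx_trmx_sum; under eq_bigr do rewrite mulrC.
rewrite gexp_sum => [|l]; last by apply: gintZ; exact: gint_coord.
by rewrite big1// => l _; rewrite gexpZ ?gexp_coord ?mulr0//; exact: gint_coord.
Qed.

Let bilinearE p q :
  (fun y => (y *m p^T) 0 0 * (y *m q^T) 0 0) =
  fun y => \sum_l \sum_l' p 0 l * q 0 l' * (y 0 l * y 0 l').
Proof.
apply/funext => y; rewrite !mulmx_trmx_sum mulr_suml; apply: eq_bigr => l _.
by rewrite mulr_sumr; apply: eq_bigr => l' _; ring.
Qed.

Lemma gint_bilinear p q : gint (fun y => (y *m p^T) 0 0 * (y *m q^T) 0 0).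
Proof.
rewrite bilinearE; apply: gint_sum => l; apply: gint_sum => l'.
by apply: gintZ; exact: gint_coord2.
Qed.

Lemma gexp_bilinear p q :
  gexp (fun y => (y *m p^T) 0 0 * (y *m q^T) 0 0) = gvar * (p *m q^T) 0 0.
Proof.
have I2 l l' c : gint (fun y : 'rV[R]_k => c * (y 0 l * y 0 l')).
  by apply: gintZ; exact: gint_coord2.
rewrite bilinearE gexp_sum => [|l]; last by apply: gint_sum => l'; exact: I2.
rewrite mulmx_trmx_sum mulr_sumr; apply: eq_bigr => l _.
rewrite gexp_sum => [|l']; last exact: I2.
rewrite (bigD1 l)//= big1 => [|l' ll'].
  by rewrite gexpZ ?gexp_coord2 ?eqxx ?addr0 1?mulrC//; exact: gint_coord2.
rewrite gexpZ ?gexp_coord2; last exact: gint_coord2.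
by rewrite eq_sym (negPf ll') mulr0.
Qed.

Lemma gint_moment d : (d <= 6)%N -> gint (fun y : 'rV[R]_k => (1 + `|y|) ^+ d).
Proof.
move=> d6; have cn : continuous (fun y : 'rV[R]_k => 1 + `|y|).
  apply: (@continuous_of_increment _ _ _ _ 1) => y h.
  rewrite mul1r opprD addrACA subrr add0r (le_trans (ler_dist_dist _ _))//.
  by rewrite addrAC subrr add0r lerDl exprn_ge0.
apply: (@gint_poly _ _ _ 1) => // [y|y].
  exact: (continuous_comp (cn y) (@exprn_continuous _ d _)).
by rewrite mul1r ger0_norm ?exprn_ge0 ?addr_ge0// ler_weXn2l// lerDl.
Qed.

Lemma gexp_moment_ge0 d : (d <= 6)%N -> 0 <= gexp (fun y : 'rV[R]_k => (1 + `|y|) ^+ d).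
Proof.
move=> d6; rewrite -(@gexp_cst R k 0); apply: gexp_le; [exact: gint_cst|exact:
    gint_moment|].
by move=> y; rewrite exprn_ge0 ?addr_ge0.
Qed.

End GaussForms.

Section Expansion.
Context {R : realType} {n k : nat} {k_ : 'I_n -> nat}.
Variables (A : forall j, 'M[R]_(k, k_ j)) (lo hi : 'I_n -> R) (C : 'M[R]_k).
Variables (B : 'rV[R]_n -> R) (M T : R).
Hypotheses (M0 : 0 <= M) (T0 : 0 <= T).
Local Notation S := (sqrtmx C).

Definition box (z : 'rV[R]_n) := forall j, lo j <= z 0 j <= hi j.

Hypothesis B_taylor : forall m z, box m -> box z ->
  `|B z - B m - \sum_i (z - m) 0 i * partial i B m
    - 2^-1 * \sum_j \sum_i (z - m) 0 j * (z - m) 0 i * partial i (partial j B) m|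
  <= T * `|z - m| ^+ 3.
Hypothesis B_hess : forall m i j, box m -> `|partial i (partial j B) m| <= T.
Hypothesis B_bounded : forall m, box m -> `|B m| <= T.
Hypothesis B_continuous : forall m, box m -> {for m, continuous B}.

(** The quadratic form of the block matrix at the blocks [w j], with C split as S S. This is the
    shape produced by the covariances of the linear forms y S A_j w_j^T. *)
Definition hess_form (m : 'rV[R]_n) (w : forall j, 'rV[R]_(k_ j)) : R :=
  \sum_j \sum_i partial i (partial j B) m *
    ((S *m A j *m (w j)^T)^T *m (S *m A i *m (w i)^T)) 0 0.

(** The increment [D] around the mean equals [s * d] up to O(s^2), where [d] is a linear form in the
    Gaussian variable; hence products of two increments are s^2 times products of [d] up to O(s^3).
    The time s^2 / 2 is chosen so that the displacement is s times y S. *)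
Lemma heat_expansion : exists2 K, 0 <= K & forall v g, tame A lo hi M v g ->
  forall x (s : R), 0 <= s <= 1 ->
  `|heat C (s ^+ 2 / 2) (B \o v) x - B (heat_vec C (s ^+ 2 / 2) v x)
    - s ^+ 2 / 2 * gvar * hess_form (heat_vec C (s ^+ 2 / 2) v x) (fun j => g j x)|
  <= K * s ^+ 3.
Proof.
have [c c0 hc] := mulmx_norm_le S.
have [c' c'0 hc'] := linear_form_le A M0.
pose kap : R := gexp (fun y : 'rV[R]_k => (1 + `|y|) ^+ 2).
have kap0 : 0 <= kap by exact: gexp_moment_ge0.
pose W : R := gexp (fun y : 'rV[R]_k => (1 + `|y|) ^+ 6).
have W0 : 0 <= W by exact: gexp_moment_ge0.
(* [K1] bounds the nonlinear part of [D] and [K2] bounds [D] itself. In [K] the first term is the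
   cubic remainder of B, the second the cost of replacing products of [D] by products of [d]. *)
have [K1 K1E K10] : exists2 K1, K1 = M * c ^+ 2 * (1 + kap) & 0 <= K1.
  by eexists; first reflexivity; rewrite !mulr_ge0 ?exprn_ge0 ?addr_ge0.
have [K2 K2E K20] : exists2 K2, K2 = c' * c + K1 & 0 <= K2.
  by eexists; first reflexivity; rewrite addr_ge0 ?mulr_ge0.
have [K KE K0] : exists2 K, K = T * K2 ^+ 3 + n%:R ^+ 2 * T * (K1 * K2) & 0 <= K.
  by eexists; first reflexivity; rewrite addr_ge0 ?mulr_ge0 ?exprn_ge0 ?mulr_ge0.
exists (K * W); first exact: mulr_ge0.
move=> v g tv x s /andP[s0 s1]; set m := heat_vec _ _ _ _.
have [vb gM _ vt] := tv.
have sE : Num.sqrt (2 * (s ^+ 2 / 2)) = s.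
  by rewrite mulrC divfK// sqrtr_sqr ger0_norm.
pose X y := x + s *: (y *m S).
pose d j (y : 'rV[R]_k) := (y *m S *m A j *m (g j x)^T) 0 0.
pose D j y := v (X y) 0 j - m 0 j.
have dE j : d j = fun y => (y *m ((S *m A j *m (g j x)^T)^T)^T) 0 0.
  by apply/funext => y; rewrite trmxK !mulmxA.
have mE j : m 0 j = gexp (fun y => v (X y) 0 j) by rewrite mxE heatE sE.
have bm : box m.
  have [h _ _ _] := tame_heat C M0 tv (s ^+ 2 / 2); exact: h.
have Iv j : gint (fun y => v (X y) 0 j).
  have [M' hM'] := tame_bounded tv j.
  have := @gint_heat _ _ C (fun x => v x 0 j) M' x (s ^+ 2 / 2) (tame_coord_continuous M0
      tv (j := j)) hM'.
  by rewrite sE.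
have Id j : gint (d j) by rewrite dE; exact: gint_linear.
have d_le j y : `|d j y| <= c' * c * `|y|.
  rewrite (le_trans (hc' _ _ (gM x j) _))// -mulrA ler_wpM2l//.
have e_le j y : `|v (X y) 0 j - v x 0 j - s * d j y| <= M * c ^+ 2 * s ^+ 2 * `|y| ^+ 2.
  have := vt x (s *: (y *m S)) j; rewrite -!scalemxAl mxE => /le_trans; apply.
  rewrite normrZ (ger0_norm s0).
  rewrite [leRHS](_ : _ = M * (s * (c * `|y|)) ^+ 2); last by ring.
  rewrite ler_wpM2l// lerXn2r ?nnegrE ?mulr_ge0// ler_wpM2l//.
(* The linear form has mean zero, so passing from v(x) to the mean costs only O(s^2). *)
have m_le j : `|m 0 j - v x 0 j| <= M * c ^+ 2 * s ^+ 2 * kap.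
  have Ie : gint (fun y => v (X y) 0 j - v x 0 j - s * d j y).
    by apply: gintB; [apply: gintB => //; exact: gint_cst|exact: gintZ].
  have -> : m 0 j - v x 0 j = gexp (fun y => v (X y) 0 j - v x 0 j - s * d j y).
    rewrite gexpB; last 2 first.
    - by apply: gintB => //; exact: gint_cst.
    - exact: gintZ.
    rewrite gexpB ?gexp_cst ?mE//; last exact: gint_cst.
    by rewrite gexpZ// dE gexp_linear mulr0 subr0.
  rewrite /kap -gexpZ; last exact: gint_moment.
  apply: gexp_norm_le => //; first by apply: gintZ; exact: gint_moment.
  move=> y; apply: (le_trans (e_le j y)); rewrite ler_wpM2l//.
    by rewrite !mulr_ge0// exprn_ge0.
  by rewrite lerXn2r ?nnegrE ?addr_ge0// lerDr.
have y1 y : 1 <= 1 + `|y| by rewrite lerDl.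
have r_le j y : `|D j y - s * d j y| <= K1 * s ^+ 2 * (1 + `|y|) ^+ 2.
  have -> : D j y - s * d j y = (v (X y) 0 j - v x 0 j - s * d j y) - (m 0 j - v x 0 j).
    by rewrite /D; ring.
  apply: (le_trans (ler_normB _ _)); apply: (le_trans (lerD (e_le j y) (m_le j))).
  rewrite -mulrDr (_ : K1 * _ * _ = M * c ^+ 2 * s ^+ 2 * ((1 + kap) * (1 + `|y|) ^+ 2));
      last by rewrite K1E; ring.
  apply: ler_wpM2l; first by rewrite !mulr_ge0// exprn_ge0.
  rewrite mulrDl mul1r lerD//.
    by rewrite lerXn2r ?nnegrE ?addr_ge0// lerDr.
  by rewrite ler_peMr// exprn_ege1.
have a0 y : 0 <= 1 + `|y| by exact: addr_ge0.
have d_le2 j y : `|d j y| <= c' * c * (1 + `|y|) ^+ 2.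
  apply: (le_trans (d_le j y)); rewrite ler_wpM2l ?mulr_ge0// (@le_trans _ _ (1 +
      `|y|))// ?lerDr//.
  by rewrite ler_eXnr.
have D_le j y : `|D j y| <= K2 * s * (1 + `|y|) ^+ 2.
  have := ler_normD (D j y - s * d j y) (s * d j y); rewrite subrK => /le_trans; apply.
  apply: (le_trans (lerD (r_le j y) (lexx _))).
  rewrite normrM (ger0_norm s0) K2E 2!mulrDl addrC lerD//.
    by rewrite mulrAC mulrC ler_wpM2r.
  by rewrite ler_wpM2r ?exprn_ge0// ler_wpM2l// expr2 ler_piMr.
have DD_le i j y : `|D i y * D j y - s ^+ 2 * (d i y * d j y)| <= 2 * (K1 * K2) * s ^+ 3
    * (1 + `|y|) ^+ 6.
  have -> : D i y * D j y - s ^+ 2 * (d i y * d j y) =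
    (D i y - s * d i y) * D j y + s * d i y * (D j y - s * d j y) by ring.
  apply: (le_trans (ler_normD _ _)); rewrite !normrM (ger0_norm s0).
  have dK : `|d i y| <= K2 * (1 + `|y|) ^+ 2.
    by rewrite (le_trans (d_le2 i y))// ler_wpM2r ?exprn_ge0// K2E lerDl.
  apply: (@le_trans _ _ (K1 * s ^+ 2 * (1 + `|y|) ^+ 2 * (K2 * s * (1 + `|y|) ^+ 2) +
     s * (K2 * (1 + `|y|) ^+ 2) * (K1 * s ^+ 2 * (1 + `|y|) ^+ 2))).
    apply: lerD; first by apply: ler_pM.
    by apply: ler_pM => //; [exact: mulr_ge0|exact: ler_wpM2l].
  rewrite [leLHS](_ : _ = 2 * (K1 * K2) * s ^+ 3 * (1 + `|y|) ^+ 4); last by ring.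
  by rewrite ler_wpM2l ?mulr_ge0 ?exprn_ge0// ler_weXn2l.
(* The quadratic term is written with [d] rather than [D]: its expectation is then exactly the
   multiple of [hess_form] in the statement. *)
pose Y y := B (v (X y)) - B m - \sum_i D i y * partial i B m
   - s ^+ 2 / 2 * \sum_j \sum_i d j y * d i y * partial i (partial j B) m.
have zmE y i : (v (X y) - m) 0 i = D i y by rewrite mxE [X in _ + X]mxE.
have Y_le y : `|Y y| <= K * s ^+ 3 * (1 + `|y|) ^+ 6.
  have := B_taylor bm (vb (X y)).
  under eq_bigr do rewrite zmE.
  under [X in 2^-1 * X]eq_bigr do under eq_bigr do rewrite !zmE.
  set tay := (X in `|X| <= _) => tay_le.
  have -> : Y y = tay + 2^-1 * \sum_j \sum_i
      (D j y * D i y - s ^+ 2 * (d j y * d i y)) * partial i (partial j B) m.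
    rewrite /Y /tay.
    have -> : \sum_j \sum_i (D j y * D i y - s ^+ 2 * (d j y * d i y)) * partial i
        (partial j B) m =
      \sum_j \sum_i D j y * D i y * partial i (partial j B) m -
      s ^+ 2 * \sum_j \sum_i d j y * d i y * partial i (partial j B) m.
      rewrite mulr_sumr -sumrB; apply: eq_bigr => j _.
      by rewrite mulr_sumr -sumrB; apply: eq_bigr => i _; ring.
    by field.
  apply: (le_trans (ler_normD _ _)).
  rewrite KE mulrDl mulrDl lerD//.
    apply: (le_trans tay_le).
    rewrite [leRHS](_ : _ = T * (K2 * s * (1 + `|y|) ^+ 2) ^+ 3); last by ring.
    rewrite ler_wpM2l// lerXn2r ?nnegrE ?mulr_ge0 ?exprn_ge0//.
    apply: row_norm_le => [|l]; first by rewrite !mulr_ge0 ?exprn_ge0.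
    by rewrite zmE.
  rewrite normrM ger0_norm//.
  apply: (@le_trans _ _ (2^-1 * (n%:R * (n%:R * (2 * (K1 * K2) * s ^+ 3 * (1 + `|y|) ^+ 6
      * T))))).
    rewrite ler_wpM2l//.
    have sum_le (F : 'I_n -> R) c0' : (forall i, `|F i| <= c0') -> `|\sum_i F i| <= n%:R
        * c0'.
      move=> h; apply: (le_trans (ler_norm_sum _ _ _)).
      by rewrite mulr_natl -[n in leRHS]card_ord -sumr_const ler_sum.
    apply: (sum_le) => j'; apply: sum_le => i'; rewrite normrM ler_pM//.
    exact: B_hess.
  by rewrite le_eqVlt; apply/orP; left; apply/eqP; field.
have cBv : continuous (B \o v).
  move=> y; apply: continuous_comp; first exact: (tame_continuous M0 tv).
  exact/B_continuous/vb.
have IB : gint (fun y => B (v (X y))).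
  have := @gint_heat _ _ C (B \o v) T x (s ^+ 2 / 2) cBv (fun y => B_bounded (vb y)).
  by rewrite sE.
have ID i : gint (D i) by apply: gintB => //; exact: gint_cst.
have ED i : gexp (D i) = 0 by rewrite gexpB ?gexp_cst ?mE ?subrr//; exact: gint_cst.
have IDp i : gint (fun y => D i y * partial i B m).
  by under eq_fun do rewrite mulrC; exact: gintZ.
have Idd j i : gint (fun y => d j y * d i y) by rewrite !dE; exact: gint_bilinear.
have Iddp j i : gint (fun y => d j y * d i y * partial i (partial j B) m).
  by under eq_fun do rewrite mulrC; exact: gintZ.
have Iss : gint (fun y => \sum_j \sum_i d j y * d i y * partial i (partial j B) m).
  by apply: gint_sum => j; apply: gint_sum => i.
have ID1 : gint (fun y => \sum_i D i y * partial i B m) by exact: gint_sum.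
have I1 : gint (fun y => B (v (X y)) - B m) by apply: gintB => //; exact: gint_cst.
have I2 := gintB I1 ID1.
have I3 := gintZ (s ^+ 2 / 2) Iss.
have IY : gint Y := gintB I2 I3.
have EY : gexp Y = heat C (s ^+ 2 / 2) (B \o v) x - B m
    - s ^+ 2 / 2 * gvar * hess_form m (fun j => g j x).
  rewrite [LHS](gexpB I2 I3) (gexpB I1 ID1) (gexpB IB (gint_cst _)) gexp_cst.
  rewrite gexp_sum// big1 ?subr0 => [|i _]; last first.
    under eq_fun do rewrite mulrC.
    by rewrite gexpZ// ED mulr0.
  rewrite heatE sE; congr (_ - _); rewrite (gexpZ _ Iss) -[RHS]mulrA; congr (_ * _).
  rewrite gexp_sum => [|j]; last exact: gint_sum.
  rewrite /hess_form mulr_sumr; apply: eq_bigr => j _.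
  rewrite gexp_sum// mulr_sumr; apply: eq_bigr => i _.
  under eq_fun do rewrite mulrC.
  by rewrite gexpZ// !dE gexp_bilinear trmxK mulrCA.
rewrite -EY -mulrA (mulrC W) mulrA /W -gexpZ; last exact: gint_moment.
by apply: gexp_norm_le => //; apply: gintZ; exact: gint_moment.
Qed.

End Expansion.

(** * From the Hessian condition to the inequality *)

Lemma hess_form_block (R : realType) (n k : nat) (k_ : 'I_n -> nat)
    (A : forall j, 'M[R]_(k, k_ j)) (C : 'M[R]_k) (B : 'rV[R]_n -> R) z
    (w : forall j, 'rV[R]_(k_ j)) :
  (sqrtmx C)^T = sqrtmx C -> sqrtmx C *m sqrtmx C = C ->
  hess_form A C B z w =
  (\mxrow_j w j *m block_hadamard A C (hessian B z) *m (\mxrow_j w j)^T) 0 0.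
Proof.
move=> symS SS; rewrite /hess_form /block_hadamard mul_mxrow_mxblock tr_mxrow.
rewrite mul_mxrow_mxcol summxE; apply: eq_bigr => j _.
rewrite mulmx_suml summxE; apply: eq_bigr => i _.
rewrite -scalemxAr -scalemxAl [RHS]mxE [hessian _ _ _ _]mxE; congr (_ * _).
set p := sqrtmx C *m A j *m _; set q := sqrtmx C *m A i *m _.
have -> : w i *m ((A i)^T *m C *m A j) *m (w j)^T = q^T *m p.
  by rewrite /p /q !trmx_mul !trmxK symS -{1}SS !mulmxA.
have -> : q^T *m p = (p^T *m q)^T by rewrite [RHS]trmx_mul trmxK.
by rewrite [RHS]mxE.
Qed.

(** * Compact boxes of values inside the rectangle *)

Section Box.
Context {R : realType}.

Lemma rowspace_closed m r (D : 'M[R]_(r, m)) :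
  closed [set y : 'rV[R]_m | y *m cokermx D = 0].
Proof.
have -> : [set y : 'rV[R]_m | y *m cokermx D = 0] =
    \bigcap_(l in [set: 'I_m]) (fun y : 'rV[R]_m => (y *m cokermx D) 0 l) @^-1` [set 0].
  apply/seteqP; split => [y /= h l _|y hy /=]; first by rewrite /= h mxE.
  by apply/rowP => l; rewrite (hy l)// mxE.
apply: closed_bigI => l _; apply: preimage_closed; last exact: closed_eq.
move=> y _.
exact: (continuous_comp (@continuous_mulmx _ _ _ (cokermx D) y) (@coord_continuous _ _ _
    0 l _)).
Qed.

(** When x -> x D has a kernel, x -> f (x D) need not be compactly supported, so the maximum is
    taken over the support of f intersected with the row space of D, a closed set. It is attained at
    some x D; elsewhere on the row space f is 0, which explains P 0. *)
Lemma compact_support_max m r (D : 'M[R]_(r, m)) (f : 'rV[R]_m -> R) (P : R -> Prop) :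
  continuous f -> compactly_supported f -> P 0 ->
  (forall x : 'rV[R]_r, P (f (x *m D))) ->
  exists2 b, P b & forall x : 'rV[R]_r, f (x *m D) <= b.
Proof.
move=> cf cK i0 fi; pose K := closure [set x | f x != 0].
pose T := K `&` [set y : 'rV[R]_m | y *m cokermx D = 0].
have cT : compact T by apply: compact_closedI => //; exact: rowspace_closed.
have f0 x : ~ T (x *m D) -> f (x *m D) = 0.
  move=> nT; apply: contrapT => /eqP fx; apply: nT; split; first exact: subset_closure.
  by rewrite /= -mulmxA mulmx_coker mulmx0.
have [T0|/set0P T0] := eqVneq T set0.
  by exists 0 => // x; rewrite f0// T0.
have [|c /set_mem Tc hc] := @compact_EVT_max _ R f T T0 cT.
  exact: continuous_subspaceT.
have [x cE] : exists x, c = x *m D.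
  case: Tc => _ /= c0; have /submxP[x ->] : (c <= D)%MS by rewrite submxE c0.
  by exists x.
exists (Num.max 0 (f c)) => [|y].
  by rewrite /Num.max; case: ifP => // _; rewrite cE.
rewrite le_max; have [Ty|nTy] := pselect (T (y *m D)).
  by rewrite hc ?orbT//; exact/mem_set.
by rewrite f0// lexx.
Qed.

Lemma interval_convex (i : interval R) a b c : a \in i -> b \in i -> a <= c <= b -> c \in i.
Proof. by move=> ai bi; exact: (@interval_is_interval R i a b ai bi). Qed.

Lemma compact_support_min m r (D : 'M[R]_(r, m)) (f : 'rV[R]_m -> R) (P : R -> Prop) :
  continuous f -> compactly_supported f -> P 0 ->
  (forall x : 'rV[R]_r, P (f (x *m D))) ->
  exists2 b, P b & forall x : 'rV[R]_r, b <= f (x *m D).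
Proof.
move=> cf cK P0 Pf.
have [||||b Pb fb] := @compact_support_max _ _ D (fun x => - f x) (fun t => P (- t)).
- by move=> x; apply: continuousN; exact: cf.
- rewrite /compactly_supported (_ : [set x | - f x != 0] = [set x | f x != 0])//.
  by apply/funext => x /=; rewrite oppr_eq0.
- by rewrite oppr0.
- by move=> x; rewrite opprK.
by exists (- b) => // x; rewrite lerNl.
Qed.

Context {n k : nat} {k_ : 'I_n -> nat}.
Variables (A : forall j, 'M[R]_(k, k_ j)) (I : 'I_n -> interval R).

(** The extrema are attained or equal to 0, so the corners lie in the intervals and the compact box
    stays inside the rectangle even when the sides are open. *)
Lemma admissible_box (u : forall j, 'rV[R]_(k_ j) -> R) :
  rectangle I 0 -> admissible A (rectangle I) u ->
  exists lo hi : 'I_n -> R,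
    (forall j, lo j \in I j /\ hi j \in I j) /\
    (forall x j, lo j <= u j (x *m A j) <= hi j).
Proof.
move=> I0 [su uI].
have cu j : continuous (u j) by move=> y; exact: (smooth_on_continuous (su j).1).
have uI' j x : u j (x *m A j) \in I j by have := uI x j; rewrite mxE.
have I0' j : 0 \in I j by have := I0 j; rewrite mxE.
have /choice[hi hhi] : forall j, exists b, b \in I j /\ forall x : 'rV[R]_k, u j (x *m A
    j) <= b.
  by move=> j; have [b] := compact_support_max (P := fun t => t \in I j) (cu j) (su j).2
      (I0' j) (uI' j); exists b.
have /choice[lo hlo] : forall j, exists b, b \in I j /\ forall x : 'rV[R]_k, b <= u j (x
    *m A j).
  by move=> j; have [b] := compact_support_min (P := fun t => t \in I j) (cu j) (su j).2
      (I0' j) (uI' j); exists b.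
exists lo, hi; split => [j|x j]; first by case: (hlo j); case: (hhi j).
by case: (hlo j) => _ ->; case: (hhi j) => _ ->.
Qed.
End Box.

Section BoxConstants.
Context {R : realType} {n : nat}.
Variables (lo hi : 'I_n -> R) (U : set 'rV[R]_n) (B : 'rV[R]_n -> R).
Hypotheses (sB : smooth_on U B) (boxU : forall z, box lo hi z -> U z).

Lemma box_compact : compact (box lo hi).
Proof.
have := @rV_compact R n (fun j => `[lo j, hi j]%classic) (fun j => @segment_compact _ _ _).
by rewrite (_ : [set v : 'rV[R]_n | _] = box lo hi).
Qed.

Lemma box_segment m z (s : R) : box lo hi m -> box lo hi z -> 0 <= s <= 1 ->
  box lo hi (m + s *: (z - m)).
Proof.
move=> bm bz /andP[s0 s1] j; rewrite !mxE.
have /andP[m1 m2] := bm j; have /andP[z1 z2] := bz j.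
apply/andP; split; nra.
Qed.

Lemma box_constants : exists2 T, 0 <= T &
  [/\ forall m z, box lo hi m -> box lo hi z ->
        `|B z - B m - \sum_i (z - m) 0 i * partial i B m
         - 2^-1 * \sum_j \sum_i (z - m) 0 j * (z - m) 0 i * partial i (partial j B) m|
        <= T * `|z - m| ^+ 3,
      forall m i j, box lo hi m -> `|partial i (partial j B) m| <= T,
      forall m, box lo hi m -> `|B m| <= T &
      forall m, box lo hi m -> {for m, continuous B}].
Proof.
have cB m : box lo hi m -> {for m, continuous B}.
  by move=> /boxU; exact: smooth_on_continuous.
have [T1 hT1] := compact_continuous_bounded box_compact cB.
have [T2 T20 hT2] := compact_continuous_bounded_family box_compact
  (fun (ij : 'I_n * 'I_n) x bx => smooth_on_continuous
    (smooth_on_partial ij.1 (smooth_on_partial ij.2 sB)) (boxU bx)).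
have [T3 T30 hT3] := compact_continuous_bounded_family box_compact
  (fun (ijl : 'I_n * 'I_n * 'I_n) x bx => smooth_on_continuous
    (smooth_on_partial ijl.1.1 (smooth_on_partial ijl.1.2 (smooth_on_partial ijl.2 sB)))
        (boxU bx)).
have c30 : 0 <= n%:R ^+ 3 * T3 by rewrite mulr_ge0// exprn_ge0.
exists (`|T1| + T2 + n%:R ^+ 3 * T3); first by rewrite !addr_ge0.
split => // [m z bm bz|m i j bm|m bm].
- apply: (@le_trans _ _ (n%:R ^+ 3 * T3 * `|z - m| ^+ 3)).
    have := @smooth_taylor2_le R n U B m (z - m) T3 sB.
    rewrite (_ : m + (z - m) = z); last by rewrite addrCA subrr addr0.
    apply; first by move=> s s01; exact/boxU/box_segment.
    by move=> s s01 i j l; exact/(hT3 (i, j, l))/box_segment.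
  by rewrite ler_wpM2r ?exprn_ge0// lerDr addr_ge0.
- by rewrite (le_trans (hT2 (i, j) m bm))// addrAC lerDr addr_ge0.
- by rewrite (le_trans (hT1 m bm))// (le_trans (ler_norm _))// -addrA lerDl addr_ge0.
Qed.
End BoxConstants.

(** * Accumulation of the error over many short steps *)

Section Iteration.
Context {R : realType} {n k : nat} {k_ : 'I_n -> nat}.
Variables (A : forall j, 'M[R]_(k, k_ j)) (lo hi : 'I_n -> R) (C : 'M[R]_k).
Variables (B : 'rV[R]_n -> R) (M T K : R).
Hypotheses (k0 : (0 < k)%N) (M0 : 0 <= M) (K0 : 0 <= K).
Hypothesis B_bounded : forall m, box lo hi m -> `|B m| <= T.
Hypothesis B_continuous : forall m, box lo hi m -> {for m, continuous B}.
Hypothesis hess_le0 : forall m w, box lo hi m -> hess_form A C B m w <= 0.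
Hypothesis expansion : forall v g, tame A lo hi M v g ->
  forall x (s : R), 0 <= s <= 1 ->
  `|heat C (s ^+ 2 / 2) (B \o v) x - B (heat_vec C (s ^+ 2 / 2) v x)
    - s ^+ 2 / 2 * gvar * hess_form A C B (heat_vec C (s ^+ 2 / 2) v x) (fun j => g j x)|
  <= K * s ^+ 3.
Variables (v : 'rV[R]_k -> 'rV[R]_n) (g : forall j, 'rV[R]_k -> 'rV[R]_(k_ j)).
Hypothesis tv : tame A lo hi M v g.

Lemma tame_box_continuous v' g' : tame A lo hi M v' g' ->
  continuous (B \o v') /\ (forall y, `|(B \o v') y| <= T).
Proof.
move=> tv'; have [vb _ _ _] := tv'; split => y; last exact/B_bounded/vb.
apply: continuous_comp; first exact: (tame_continuous M0 tv').
exact/B_continuous/vb.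
Qed.

Lemma heat_one_step v' g' x s : tame A lo hi M v' g' -> 0 <= s <= 1 ->
  heat C (s ^+ 2 / 2) (B \o v') x <= B (heat_vec C (s ^+ 2 / 2) v' x) + K * s ^+ 3.
Proof.
move=> tv' s01; have := expansion tv' x s01.
set m := heat_vec _ _ _ _; set h := hess_form _ _ _ _ _.
have bm : box lo hi m by have [h' _ _ _] := tame_heat C M0 tv' (s ^+ 2 / 2); exact: h'.
have h0 : h <= 0 by exact: hess_le0.
rewrite ler_norml => /andP[_].
have : s ^+ 2 / 2 * gvar * h <= 0.
  rewrite mulr_ge0_le0// mulr_ge0 ?divr_ge0 ?exprn_ge0//; last exact: ltW (@gvar_gt0 R k
      k0).
  by case/andP: s01.
lra.
Qed.

Lemma heat_vec_heat_vec a b x : 0 <= a -> 0 <= b ->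
  heat_vec C a (heat_vec C b v) x = heat_vec C (a + b) v x.
Proof.
move=> a0 b0; apply/rowP => j; rewrite !mxE.
have [M' hM'] := tame_bounded tv j.
have [_ <-] := heat_heat C x (tame_coord_continuous M0 tv (j := j)) hM' a0 b0.
by congr heat; apply/funext => y; rewrite mxE.
Qed.

(** The inductive bound is averaged over one more step, which preserves order and constants; the
    one-step estimate is then applied to the already averaged function, which is tame with the same
    M and so has the same K. *)
Lemma heat_iterate s i x : 0 <= s <= 1 ->
  heat C (i%:R * (s ^+ 2 / 2)) (B \o v) x <=
  B (heat_vec C (i%:R * (s ^+ 2 / 2)) v x) + i%:R * (K * s ^+ 3).
Proof.
move=> s01; have /andP[s0 s1] := s01.
have e0 : 0 <= s ^+ 2 / 2 by rewrite divr_ge0 ?exprn_ge0.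
elim: i x => [|i IH] x.
  rewrite !mul0r heat0 addr0 /= (_ : heat_vec C 0 v x = v x)//.
  by apply/rowP => j; rewrite mxE heat0.
have ie0 : 0 <= i%:R * (s ^+ 2 / 2) by rewrite mulr_ge0.
have [cBv bBv] := tame_box_continuous tv.
set e := s ^+ 2 / 2 in e0 IH ie0 *.
have -> : i.+1%:R * e = e + i%:R * e by rewrite -natr1 mulrDl mul1r addrC.
have [Ih <-] := heat_heat C x cBv bBv e0 ie0.
have tvi := tame_heat C M0 tv (i%:R * e).
have [cBi bBi] := tame_box_continuous tvi.
apply: (@le_trans _ _ (heat C e (B \o heat_vec C (i%:R * e) v) x + i%:R * (K * s ^+ 3))).
  rewrite !heatE -[X in _ + X](@gexp_cst R k) -gexpD; last 2 first.
  - exact: (gint_heat _ _ _ cBi bBi).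
  - exact: gint_cst.
  apply: gexp_le => //.
  by apply: gintD; [exact: (gint_heat _ _ _ cBi bBi)|exact: gint_cst].
rewrite -heat_vec_heat_vec// -natr1 mulrDl mul1r addrA (addrAC (B _)) lerD2r.
exact: heat_one_step tvi s01.
Qed.

Lemma heat_concave t x : 0 <= t ->
  heat C t (B \o v) x <= B (heat_vec C t v x).
Proof.
move=> t0; apply/ler_addgt0Pr => e e0.
(* With N s^2 = 2 t the total loss N K s^3 is 2 t K s, which s <= d makes at most e. The + 1 keeps
   the denominator positive. *)
pose d := Num.min 1 (e / (2 * t * K + 1)).
have tK0 : 0 <= 2 * t * K by rewrite !mulr_ge0.
have d0 : 0 < d by rewrite lt_min ltr01 divr_gt0// ltr_wpDl.
pose N := (Num.bound (2 * t / d ^+ 2)).+1.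
have N0 : 0 < N%:R :> R by rewrite ltr0n.
have NE : 2 * t / d ^+ 2 < N%:R.
  apply: (lt_trans (archi_boundP _)); last by rewrite ltr_nat.
  by rewrite divr_ge0 ?exprn_ge0 ?mulr_ge0 ?(ltW d0).
pose s := Num.sqrt (2 * t / N%:R).
have s2 : s ^+ 2 = 2 * t / N%:R by rewrite sqr_sqrtr// divr_ge0 ?mulr_ge0.
have s0 : 0 <= s by exact: sqrtr_ge0.
have sd : s <= d.
  rewrite -(@ler_pXn2r _ 2) ?nnegrE ?(ltW d0)// s2 ler_pdivrMr// -ler_pdivrMl ?exprn_gt0//.
  by rewrite mulrC ltW.
have s1 : s <= 1 by rewrite (le_trans sd)// ge_min lexx.
have := heat_iterate N x (introT andP (conj s0 s1)).
have -> : N%:R * (s ^+ 2 / 2) = t by rewrite s2; field; rewrite gt_eqF.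
move=> /le_trans; apply; rewrite lerD2l.
have -> : N%:R * (K * s ^+ 3) = 2 * t * K * s.
  have -> : s ^+ 3 = s ^+ 2 * s by ring.
  by rewrite s2; field; rewrite gt_eqF.
apply: (@le_trans _ _ ((2 * t * K + 1) * (e / (2 * t * K + 1)))).
  apply: ler_pM => //; first by rewrite lerDl.
  by rewrite (le_trans sd)// ge_min lexx orbT.
by rewrite mulrC divfK// gt_eqF// ltr_wpDl.
Qed.

End Iteration.

(** * Bump functions *)

Section Flat.
Context {R : realType}.
Implicit Types p : {poly R}.

(** The functions p(1/t) e^(-1/t), extended by 0, form a class closed under differentiation;
    smoothness of the classical e^(-1/t) thus reduces to differentiability of each member. *)
Definition flat p (t : R) : R := if 0 < t then p.[t^-1] * expR (- t^-1) else 0.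

(* The derivative of p(1/t) e^(-1/t) is q(1/t) e^(-1/t) with q = X^2 (p - p'). *)
Definition flat_deriv p : {poly R} := 'X^2 * (p - p^`()).

Lemma exprn_le_expR n (y : R) : 0 <= y -> y ^+ n <= n`!%:R * expR y.
Proof.
case: n => [|n] y0; first by rewrite expr0 mul1r -expR0 ler_expR.
have := expR_ge1Dxn n y0 => h.
rewrite mulrC -ler_pdivrMr ?ltr0n ?fact_gt0//; apply: le_trans h.
by rewrite lerDr.
Qed.

Lemma poly_le_expR p : exists2 c, 0 <= c & forall y, 0 <= y -> `|p.[y]| <= c * expR y.
Proof.
exists (\sum_(i < size p) `|p`_i| * i`!%:R); first by apply: sumr_ge0 => i _; rewrite
    mulr_ge0.
move=> y y0; rewrite horner_coef (le_trans (ler_norm_sum _ _ _))// mulr_suml ler_sum// =>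
    i _.
by rewrite normrM -mulrA ler_wpM2l// ger0_norm ?exprn_ge0// exprn_le_expR.
Qed.

(** The exponential beats p(1/t) t^-2. A quadratic bound is what makes the difference quotient at 0
    tend to 0. *)
Lemma flat_le p : exists2 c, 0 <= c & forall t, `|flat p t| <= c * t ^+ 2.
Proof.
have [c c0 hc] := poly_le_expR (p * 'X^2); exists c => // t; rewrite /flat.
case: ifPn => [t0|_]; last by rewrite normr0 mulr_ge0// exprn_even_ge0.
have t20 : 0 <= t^-1 ^+ 2 by rewrite exprn_ge0// invr_ge0 ltW.
have h : `|p.[t^-1]| * t^-1 ^+ 2 <= c * expR t^-1.
  rewrite -[t^-1 ^+ 2](ger0_norm t20) -normrM -hornerXn -hornerM.
  by rewrite hc// invr_ge0 ltW.
rewrite normrM (ger0_norm (expR_ge0 _)) expRN ler_pdivrMr ?expR_gt0//.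
rewrite mulrAC -ler_pdivrMr ?exprn_gt0//; apply: le_trans h.
by rewrite exprVn.
Qed.

Lemma is_derive_flat p (t : R) : is_derive t 1 (flat p) (flat (flat_deriv p) t).
Proof.
have [t0|t0|->] := ltgtP t 0.
- rewrite /flat [0 < t]ltNge (ltW t0)/=.
  apply: (@near_eq_is_derive _ _ _ (cst 0)).
  near=> s; rewrite /cst ifN// -leNgt ltW//; near: s.
  by apply: (@open_nbhs_nbhs _ t [set s | s < 0]); split; [exact: open_lt|].
- have -> : flat (flat_deriv p) t = (flat_deriv p).[t^-1] * expR (- t^-1) by rewrite
    /flat t0.
  apply: (@near_eq_is_derive _ _ _ (fun s : R => p.[s^-1] * expR (- s^-1))).
    near=> s; rewrite /flat ifT//; near: s.
    by apply: (@open_nbhs_nbhs _ t [set s | 0 < s]); split; [exact: open_gt|].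
  have dinv : is_derive t 1 (fun s : R => s^-1) (- t ^- 2).
    have := @is_deriveV R id t 1 1 (lt0r_neq0 t0) (is_derive_id _ _).
    by rewrite /GRing.scale/= mulr1.
  have dp : is_derive t^-1 1 (horner p) (p^`().[t^-1]).
    by apply: DeriveDef; [exact: derivable_horner|rewrite derivE derive1E].
  have dph := is_derive1_comp dp dinv.
  have deh := @is_derive1_comp R expR (fun s : R => - s^-1) t _ _ (is_derive_expR (-
      t^-1)) (is_deriveN dinv).
  have := is_deriveM dph deh; set D := (X in is_derive _ _ _ X) => hD.
  rewrite (_ : _ * _ = D); first exact: hD.
  have -> : D = p.[t^-1] * (expR (- t^-1) * (- - t ^- 2)) +
      expR (- t^-1) * (p^`().[t^-1] * - t ^- 2) by [].
  by rewrite /flat_deriv hornerM hornerXn hornerD hornerN exprVn; ring.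
have [c c0 hc] := flat_le p.
rewrite {2}/flat ltxx.
have f0 : flat p 0 = 0 by rewrite /flat ltxx.
have cv : (fun h : R => h^-1 *: ((flat p \o shift 0) (h *: 1) - flat p 0)) @ 0^' --> (0 :
    R).
  apply/cvgrPdist_le => e e0; near=> h.
  have h0 : h != 0 by near: h; exact: nbhs_dnbhs_neq.
  rewrite /= f0 subr0 addr0 sub0r normrN /GRing.scale/= mulr1 normrM normfV.
  rewrite ler_pdivrMl ?normr_gt0// (le_trans (hc h))//.
  rewrite -(real_normK (num_real h)) expr2 mulrCA ler_wpM2l//.
  have he : `|h| <= e / (c + 1).
    by near: h; apply: dnbhs0_le; rewrite divr_gt0// ltr_wpDl.
  rewrite (le_trans (ler_wpM2l c0 he))// mulrA ler_pdivrMr ?ltr_wpDl//.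
  by rewrite mulrC ler_wpM2l ?(ltW e0)// lerDl.
apply: DeriveDef; first by apply/cvg_ex; exists 0.
exact: cvg_lim cv.
Unshelve. all: by end_near.
Qed.
End Flat.

(** * An algebra of smooth functions containing the cut-offs *)

Section BumpAlgebra.
Context {R : realType} {m : nat}.
Variables (r2 s2 : R).
Implicit Types f g : 'rV[R]_m -> R.

Definition paraboloid (y : 'rV[R]_m) : R := r2 - s2 * \sum_l y 0 l ^+ 2.

Lemma is_derive_coord (x v : 'rV[R]_m) l :
  is_derive x v (fun y : 'rV[R]_m => y 0 l) (v 0 l).
Proof.
have cv : (fun h : R => h^-1 *: (((fun y : 'rV[R]_m => y 0 l) \o shift x) (h *: v) - x 0
    l)) @ 0^'
    --> (v 0 l : R).
  apply/cvgrPdist_le => e e0; near=> h.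
  have h0 : h != 0 by near: h; exact: nbhs_dnbhs_neq.
  by rewrite /= !mxE addrK /GRing.scale/= mulKf// subrr normr0 ltW.
apply: DeriveDef; first by apply/cvg_ex; exists (v 0 l).
exact: cvg_lim cv.
Unshelve. all: by end_near.
Qed.

Lemma paraboloidE : paraboloid =
  cst r2 - cst s2 * \sum_l ((fun y : 'rV[R]_m => y 0 l) * (fun y : 'rV[R]_m => y 0 l)).
Proof.
by apply/funext => y; rewrite /paraboloid !fctE fct_sumE; under eq_bigr do rewrite expr2.
Qed.

Lemma differentiable_paraboloid x : differentiable paraboloid x.
Proof.
rewrite paraboloidE; apply: differentiableB; first exact: differentiable_cst.
apply: differentiableM; first exact: differentiable_cst.
apply: differentiable_sum => l.
by apply: differentiableM; exact: differentiable_coord.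
Qed.

Lemma partial_paraboloid i x : partial i paraboloid x = - (2 * s2) * x 0 i.
Proof.
have dc := fun l => is_derive_coord x (delta_mx 0 i) l.
rewrite /partial paraboloidE.
have ds : is_derive x (delta_mx 0 i)
    (\sum_l ((fun y : 'rV[R]_m => y 0 l) * (fun y : 'rV[R]_m => y 0 l))) (2 * x 0 i).
  have := is_derive_sum (fun l => is_deriveM (dc l) (dc l)).
  set D := (X in is_derive _ _ _ X) => hD; rewrite (_ : 2 * x 0 i = D)//.
  rewrite /D (bigD1 i)//= big1 => [|l li].
    rewrite mxE !eqxx addr0 /GRing.scale/=; ring.
  by rewrite mxE eqxx (negPf li)/= scaler0 addr0.
have := is_deriveB (is_derive_cst r2 x (delta_mx 0 i)) (is_deriveM (is_derive_cst s2 x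
    (delta_mx 0 i)) ds).
move=> [_ ->]; rewrite /GRing.scale/=; ring.
Qed.

Lemma differentiable_flat_paraboloid p x :
  differentiable (fun y => flat p (paraboloid y)) x.
Proof.
apply: (@differentiable_comp _ _ _ _ paraboloid (flat p)).
  exact: differentiable_paraboloid.
by apply/derivable1_diffP; have [] := is_derive_flat p (paraboloid x).
Qed.

Lemma partial_flat_paraboloid p i x :
  partial i (fun y => flat p (paraboloid y)) x =
    flat (flat_deriv p) (paraboloid x) * (- (2 * s2) * x 0 i).
Proof.
have dr := differentiable_paraboloid x.
have [df fE] := is_derive_flat p (paraboloid x).
have dfd : differentiable (flat p) (paraboloid x) by exact/derivable1_diffP.
rewrite /partial (deriveE _ (differentiable_flat_paraboloid p x)) (diff_comp dr dfd)/=
    (diff1E dfd) derive1E fE.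
by rewrite -deriveE// -/(partial i paraboloid x) partial_paraboloid /GRing.scale/=
    [LHS]mulrC.
Qed.

(** All members are differentiable and partial derivatives stay in the algebra, so smoothness
    follows by induction on the list of derivatives. *)
Inductive bump_algebra : ('rV[R]_m -> R) -> Prop :=
| BumpCst c : bump_algebra (cst c)
| BumpCoord l : bump_algebra (fun y => y 0 l)
| BumpD f g : bump_algebra f -> bump_algebra g -> bump_algebra (f + g)
| BumpM f g : bump_algebra f -> bump_algebra g -> bump_algebra (f * g)
| BumpFlat p : bump_algebra (fun y => flat p (paraboloid y)).

Lemma bump_algebra_differentiable f x : bump_algebra f -> differentiable f x.
Proof.
elim=> [c|l|g h _ dg _ dh|g h _ dg _ dh|p].
- exact: differentiable_cst.
- exact: differentiable_coord.
- exact: differentiableD.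
- exact: differentiableM.
- exact: differentiable_flat_paraboloid.
Qed.

Lemma bump_algebra_partial f i : bump_algebra f -> bump_algebra (partial i f).
Proof.
have dd g x : bump_algebra g -> derivable g x (delta_mx 0 i).
  by move=> bg; exact/diff_derivable/bump_algebra_differentiable.
elim=> [c|l|g h bg dg bh dh|g h bg dg bh dh|p].
- rewrite (_ : partial i _ = cst 0); first exact: BumpCst.
  by apply/funext => x; rewrite /partial derive_cst.
- rewrite (_ : partial i _ = cst ((delta_mx 0 i : 'rV[R]_m) 0 l)); first exact: BumpCst.
  by apply/funext => x; rewrite /partial; case: (is_derive_coord x (delta_mx 0 i) l).
- rewrite (_ : partial i _ = partial i g + partial i h); first exact: BumpD.
  by apply/funext => x; rewrite /partial deriveD//; exact: dd.
- rewrite (_ : partial i _ = g * partial i h + h * partial i g).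
    by apply: BumpD; exact: BumpM.
  by apply/funext => x; rewrite /partial deriveM//; exact: dd.
- rewrite (_ : partial i _ = (fun y => flat (flat_deriv p) (paraboloid y)) *
    (cst (- (2 * s2)) * (fun y => y 0 i))).
    apply: BumpM; first exact: BumpFlat.
    by apply: BumpM; [exact: BumpCst|exact: BumpCoord].
  by apply/funext => x; rewrite partial_flat_paraboloid.
Qed.

Lemma bump_algebra_smooth f : bump_algebra f -> smooth_on setT f.
Proof.
move=> bf s x _; apply: bump_algebra_differentiable.
by elim: s => //= i s IH; exact: bump_algebra_partial.
Qed.

End BumpAlgebra.

(** * Bumps with prescribed value and gradient at the origin *)

Section Bump.
Context {R : realType} {m : nat}.
Variables (r : R) (z : R) (w : 'rV[R]_m).
Hypothesis r0 : 0 < r.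

(** A cut-off times an affine function; [expR (r ^- 2)] normalizes the cut-off to 1 at the origin,
    and [s] dilates the argument. Only the operations of [bump_algebra] are used, so that smoothness
    is immediate. *)
Definition bump (s : R) : 'rV[R]_m -> R :=
  (fun y => flat 1 (paraboloid (r ^+ 2) (s ^+ 2) y)) *
  (cst (expR (r ^- 2)) * (cst z + cst s * \sum_l (cst (w 0 l) * (fun y : 'rV[R]_m => y 0
      l)))).

Lemma bumpE s y : bump s y = flat 1 (r ^+ 2 - s ^+ 2 * \sum_l y 0 l ^+ 2) *
  (expR (r ^- 2) * (z + s * \sum_l w 0 l * y 0 l)).
Proof. by rewrite /bump /paraboloid !fctE fct_sumE. Qed.

Lemma bump_smooth s : smooth_on setT (bump s).
Proof.
apply: (@bump_algebra_smooth _ _ (r ^+ 2) (s ^+ 2)).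
apply: BumpM; first exact: BumpFlat.
apply: BumpM; first exact: BumpCst.
apply: BumpD; first exact: BumpCst.
apply: BumpM; first exact: BumpCst.
elim/big_ind: _ => [|f g|l _]; first exact: BumpCst; first exact: BumpD.
by apply: BumpM; [exact: BumpCst|exact: BumpCoord].
Qed.

Lemma bump_scale s y : bump s y = bump 1 (s *: y).
Proof.
rewrite !bumpE expr1n !mul1r !mulr_sumr; congr (flat 1 (_ - _) * (_ * (_ + _))).
  by apply: eq_bigr => l _; rewrite mxE exprMn.
by apply: eq_bigr => l _; rewrite mxE mulrCA.
Qed.

Lemma flat1E (t : R) : 0 < t -> flat 1 t = expR (- t^-1).
Proof. by move=> t0; rewrite /flat t0 hornerC mul1r. Qed.

Lemma bump0 : bump 1 0 = z.
Proof.
rewrite bumpE !big1 => [|l _|l _]; last 2 first.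
- by rewrite mxE mulr0.
- by rewrite mxE expr0n.
rewrite !mulr0 subr0 addr0 flat1E ?exprn_gt0// mulrA -expRD addNr expR0 mul1r //.
Qed.

Lemma bump_support s y : 0 < s -> bump s y != 0 -> s ^+ 2 * \sum_l y 0 l ^+ 2 < r ^+ 2.
Proof.
move=> s0; rewrite bumpE mulf_eq0 negb_or => /andP[+ _].
by rewrite /flat subr_gt0; case: ifP => //; rewrite eqxx.
Qed.

Lemma coord_lt_support s (y : 'rV[R]_m) l : 0 < s -> s ^+ 2 * \sum_l y 0 l ^+ 2 < r ^+ 2 ->
  `|s * y 0 l| <= r.
Proof.
move=> s0 h; rewrite -(@ler_pXn2r _ 2) ?nnegrE ?(ltW r0)// real_normK ?num_real//.
apply: le_trans (ltW h); rewrite exprMn ler_wpM2l ?exprn_ge0 ?(ltW s0)//.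
by rewrite (bigD1 l)//= lerDl sumr_ge0// => i _; rewrite sqr_ge0.
Qed.

Lemma bump_compact s : 0 < s -> compactly_supported (bump s).
Proof.
move=> s0; rewrite /compactly_supported.
pose K := @box R m (fun=> - (r / s)) (fun=> r / s).
have cK : compact K by exact: box_compact.
apply: (subclosed_compact (@closed_closure _ _) cK).
have clK : closed K by apply: compact_closed => //; exact: norm_hausdorff.
rewrite [X in _ `<=` X](_ : K = closure K); last by apply/closure_id.
apply: closure_subset => y /= /(bump_support s0) h l.
have := coord_lt_support l s0 h.
by rewrite normrM (gtr0_norm s0) mulrC -ler_pdivlMr// ler_norml.
Qed.

(** The normalized cut-off lies in [0, 1] on its support, so the value lies between 0 and a number
    within d of z; convexity of the interval concludes. *)
Lemma bump_in (i : interval R) s d y : 0 < s -> 0 \in i ->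
  (forall t, `|t - z| <= d -> t \in i) -> r * \sum_l `|w 0 l| <= d -> bump s y \in i.
Proof.
move=> s0 i0 zi rd; have [->//|h] := eqVneq (bump s y) 0.
have h2 := bump_support s0 h.
set a := z + s * \sum_l w 0 l * y 0 l.
have ai : a \in i.
  apply: zi; rewrite /a addrAC subrr add0r; apply: le_trans rd.
  rewrite mulr_sumr (le_trans (ler_norm_sum _ _ _))// mulr_sumr ler_sum// => l _.
  by rewrite mulrCA normrM mulrC ler_wpM2r// coord_lt_support.
rewrite bumpE -/a mulrA; set c := flat _ _ * _.
have /andP[c0 c1] : 0 <= c <= 1.
  rewrite /c flat1E ?subr_gt0// mulr_ge0 ?expR_ge0//= -expRD -expR0 ler_expR.
  rewrite addrC subr_le0 lef_pV2 ?posrE ?exprn_gt0 ?subr_gt0// lerBlDr lerDl.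
  by rewrite mulr_ge0 ?exprn_ge0 ?(ltW s0)// sumr_ge0// => l _; rewrite sqr_ge0.
have [a0|a0] := leP 0 a.
  by apply: (interval_convex i0 ai); rewrite mulr_ge0//= ler_piMl.
apply: (interval_convex ai i0); apply/andP; split; nra.
Qed.

Lemma bump_partial0 l : partial l (bump 1) 0 = w 0 l.
Proof.
pose v : 'rV[R]_m := delta_mx 0 l.
have df : derivable (fun y : 'rV[R]_m => flat 1 (paraboloid (r ^+ 2) (1 ^+ 2) y)) 0 v.
  exact/diff_derivable/differentiable_flat_paraboloid.
(* The origin is a critical point of the cut-off, so only the affine factor contributes to the
   gradient. *)
have dfE : 'D_v (fun y : 'rV[R]_m => flat 1 (paraboloid (r ^+ 2) (1 ^+ 2) y)) 0 = 0.
  by have := partial_flat_paraboloid (r ^+ 2) (1 ^+ 2) 1 l 0; rewrite /partial mxE !mulr0.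
have df' : is_derive (0 : 'rV[R]_m) v (fun y : 'rV[R]_m => flat 1 (paraboloid (r ^+ 2) (1
    ^+ 2) y)) 0.
  exact: DeriveDef.
have ds := is_derive_sum (fun l' => is_deriveM (is_derive_cst (w 0 l') (0 : 'rV[R]_m) v)
    (is_derive_coord 0 v l')).
have dg := is_deriveM (is_derive_cst (expR (r ^- 2)) (0 : 'rV[R]_m) v)
  (is_deriveD (is_derive_cst z 0 v) (is_deriveM (is_derive_cst (1 : R) 0 v) ds)).
have [_ E] := is_deriveM df' dg.
rewrite /partial [LHS]E.
rewrite /GRing.scale/= !mulr0 !addr0 add0r mul1r.
have -> : \sum_i (w 0 i * v 0 i + (0 : 'rV[R]_m) 0 i * 0) = w 0 l.
  rewrite (bigD1 l)//= big1 => [|i il]; rewrite mxE eqxx.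
    by rewrite eqxx mulr1 mulr0 !addr0.
  by rewrite (negPf il) !mulr0 addr0.
have -> : paraboloid (r ^+ 2) (1 ^+ 2) (0 : 'rV[R]_m) = r ^+ 2.
  by rewrite /paraboloid big1 ?mulr0 ?subr0// => i _; rewrite mxE expr0n.
by rewrite flat1E ?exprn_gt0// mulrA -expRD addNr expR0 mul1r.
Qed.
End Bump.

(** * From the inequality to the Hessian condition *)

Lemma continuous_le0 (R : realType) (V : normedModType R) (phi : V -> R) (z : V) :
  {for z, continuous phi} ->
  (forall e, 0 < e -> exists2 m, `|m - z| < e & phi m <= e) -> phi z <= 0.
Proof.
move=> cphi h; apply/ler_addgt0Pr => e e0; rewrite add0r.
have e20 : 0 < e / 2 by rewrite divr_gt0.
have /cvgrPdist_lt /(_ _ e20) := cphi.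
move=> /nbhs_ballP[d /= d0 hd].
have [|m mz pm] := h (Num.min d (e / 2)); first by rewrite lt_min d0.
move: mz pm; rewrite lt_min le_min => /andP[md _] /andP[_ pm].
have := hd m; rewrite -ball_normE/= distrC => /(_ md).
rewrite ltr_distlC => /andP[+ _]; lra.
Qed.

Section HeatNear.
Context {R : realType} {n k : nat} {k_ : 'I_n -> nat}.
Variables (A : forall j, 'M[R]_(k, k_ j)) (lo hi : 'I_n -> R) (C : 'M[R]_k).

Lemma heat_scale f x (s : R) : 0 <= s ->
  heat C (s ^+ 2 / 2) f x = gexp (fun y => f (x + s *: (y *m sqrtmx C))).
Proof. by move=> s0; rewrite heatE mulrC divfK// sqrtr_sqr ger0_norm. Qed.

Lemma heat_half f x : heat C 2^-1 f x = gexp (fun y => f (x + y *m sqrtmx C)).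
Proof. by rewrite heatE mulfV// sqrtr1; under eq_fun do rewrite scale1r. Qed.

Lemma heat_vecE t (F : 'rV[R]_k -> 'rV[R]_n) x j :
  heat_vec C t F x 0 j = heat C t (fun y => F y 0 j) x.
Proof. by rewrite mxE. Qed.

(** The expansion evaluates the Hessian at the averaged point; this estimate lets that point be
    replaced by v(x) in the limit. *)
Lemma heat_vec_near M v g x : 0 <= M -> tame A lo hi M v g ->
  exists2 c, 0 <= c &
    forall s, 0 <= s <= 1 -> `|heat_vec C (s ^+ 2 / 2) v x - v x| <= c * s.
Proof.
move=> M0 tv; have [vb gM _ vt] := tv.
have [c c0 hc] := mulmx_norm_le (sqrtmx C).
have [c' c'0 hc'] := linear_form_le A M0.
pose kap : R := gexp (fun y : 'rV[R]_k => (1 + `|y|) ^+ 2).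
have kap0 : 0 <= kap by exact: gexp_moment_ge0.
have d0 : 0 <= c' * c + M * c ^+ 2 by rewrite addr_ge0 ?mulr_ge0 ?exprn_ge0.
exists ((c' * c + M * c ^+ 2) * kap) => [|s /andP[s0 s1]]; first exact: mulr_ge0.
apply: row_norm_le => [|j]; first by rewrite !mulr_ge0.
rewrite !mxE heat_scale//.
have Iv : gint (fun y => v (x + s *: (y *m sqrtmx C)) 0 j).
  have [M' hM'] := tame_bounded tv j.
  apply: (@gint_bounded _ _ _ M') => //.
  exact: (@continuous_heat_arg _ _ C (fun x => v x 0 j) x s (tame_coord_continuous M0 tv
      (j := j))).
rewrite -[X in _ - X](@gexp_cst R k) -gexpB//; last exact: gint_cst.
rewrite mulrAC /kap -gexpZ; last exact: gint_moment.
apply: gexp_norm_le; [by apply: gintB => //; exact: gint_cst|by apply: gintZ; exact: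
    gint_moment|].
move=> y; set h := s *: (y *m sqrtmx C).
have hn : `|h| <= s * (c * `|y|) by rewrite normrZ (ger0_norm s0) ler_wpM2l.
have := ler_normD (v (x + h) 0 j - v x 0 j - (h *m A j *m (g j x)^T) 0 0) ((h *m A j *m
    (g j x)^T) 0 0).
rewrite subrK => /le_trans; apply.
apply: (le_trans (lerD (vt _ _ _) (hc' j (g j x) (gM x j) h))).
have y0 := normr_ge0 y.
apply: (@le_trans _ _ (M * (s * (c * `|y|)) ^+ 2 + c' * (s * (c * `|y|)))).
  by rewrite lerD// ler_wpM2l// lerXn2r ?nnegrE ?mulr_ge0.
rewrite addrC mulrDl mulrDl lerD//.
  rewrite (_ : c' * (s * (c * `|y|)) = c' * c * s * `|y|); last by ring.
  rewrite ler_wpM2l ?mulr_ge0//; nra.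
rewrite (_ : M * _ ^+ 2 = M * c ^+ 2 * (s ^+ 2 * `|y| ^+ 2)); last by ring.
rewrite -[leRHS]mulrA ler_wpM2l ?mulr_ge0 ?exprn_ge0//.
rewrite ler_pM ?exprn_ge0//; last by rewrite lerXn2r ?nnegrE ?addr_ge0// lerDr.
by rewrite expr2 ler_piMr.
Qed.
End HeatNear.

Section Main.
Context {R : realType} {n k : nat} {k_ : 'I_n -> nat}.
Variables (A : forall j, 'M[R]_(k, k_ j)) (I : 'I_n -> interval R).
Variables (B : 'rV[R]_n -> R) (U : set 'rV[R]_n) (C : 'M[R]_k).
Hypotheses (k0 : (0 < k)%N) (I0 : rectangle I 0) (IU : rectangle I `<=` U).
Hypothesis sB : smooth_on U B.

Lemma box_rectangle lo hi : (forall j, lo j \in I j /\ hi j \in I j) ->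
  forall z, box lo hi z -> rectangle I z.
Proof. by move=> h z bz j; case: (h j) => lj hj; exact: interval_convex (bz j). Qed.

Lemma hess_form_continuous w z : U z ->
  {for z, continuous (fun m => hess_form A C B m w)}.
Proof.
move=> Uz.
rewrite (_ : (fun m => _) = \sum_j \sum_i (partial i (partial j B) *
  cst (((sqrtmx C *m A j *m (w j)^T)^T *m (sqrtmx C *m A i *m (w i)^T)) 0 0))); last first.
  by apply/funext => m; rewrite fct_sumE; apply: eq_bigr => j _; rewrite fct_sumE.
elim/big_ind: _ => [|f g cf cg|j _]; [exact: cst_continuous|exact: (continuousD cf cg)|].
elim/big_ind: _ => [|f g cf cg|i _]; [exact: cst_continuous|exact: (continuousD cf cg)|].
apply: continuousM; last exact: cst_continuous.
exact: smooth_on_continuous (smooth_on_partial i (smooth_on_partial j sB)) Uz.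
Qed.

Lemma bellman_expansion u : admissible A (rectangle I) u ->
  exists lo hi M K, [/\ 0 <= M, 0 <= K, forall z, box lo hi z -> rectangle I z,
    tame A lo hi M (joint A u) (grad_joint A u) &
    forall v g, tame A lo hi M v g -> forall x (s : R), 0 <= s <= 1 ->
    `|heat C (s ^+ 2 / 2) (B \o v) x - B (heat_vec C (s ^+ 2 / 2) v x)
      - s ^+ 2 / 2 * gvar * hess_form A C B (heat_vec C (s ^+ 2 / 2) v x) (fun j => g j x)|
    <= K * s ^+ 3].
Proof.
move=> au; have [lo [hi [Ilohi ub]]] := admissible_box I0 au.
have bI := box_rectangle Ilohi.
have [M M0 tu] := tame_joint au.1 ub.
have [T T0 [h1 h2 h3 h4]] := box_constants sB (fun z bz => IU (bI z bz)).
have [K K0 hK] := heat_expansion A C M0 T0 h1 h2 h3 h4.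
by exists lo, hi, M, K.
Qed.

Lemma heat_concave_admissible u t x :
  (forall z w, rectangle I z -> hess_form A C B z w <= 0) ->
  admissible A (rectangle I) u -> 0 <= t ->
  heat C t (B \o joint A u) x <= B (heat_vec C t (joint A u) x).
Proof.
move=> hneg au t0; have [lo [hi [M [K [M0 K0 bI tu hK]]]]] := bellman_expansion au.
have [T T0 [_ _ h3 h4]] := box_constants sB (fun z bz => IU (bI z bz)).
by apply: (heat_concave k0 M0 K0 h3 h4 _ hK tu) => // m w bm; exact/hneg/bI.
Qed.

Hypothesis local_concave : forall u, admissible A (rectangle I) u ->
  heat C 2^-1 (B \o joint A u) 0 <= B (heat_vec C 2^-1 (joint A u) 0).

Lemma hess_form_interior (z : 'rV[R]_n) (w : forall j, 'rV[R]_(k_ j)) :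
  (forall j, exists2 d, 0 < d & forall t, `|t - z 0 j| <= d -> t \in I j) ->
  hess_form A C B z w <= 0.
Proof.
move=> /(_ _)/cid2-/all_sig2[d d0 hd].
(* On the support of the bump its affine factor deviates from z_j by at most r_j times the sum,
   hence by at most d_j. The + 1 covers w_j = 0. *)
pose r j := d j / (\sum_l `|w j 0 l| + 1).
have sw0 j : 0 < \sum_l `|w j 0 l| + 1 by rewrite ltr_wpDl// sumr_ge0.
have r0 j : 0 < r j by rewrite divr_gt0.
have rd j : r j * \sum_l `|w j 0 l| <= d j.
  by rewrite mulrAC ler_pdivrMr// ler_wpM2l ?(ltW (d0 j))// lerDl.
have I0j j : 0 \in I j by have := I0 j; rewrite mxE.
pose u s j : 'rV[R]_(k_ j) -> R := bump (r j) (z 0 j) (w j) s.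
have au s : 0 < s -> admissible A (rectangle I) (u s).
  move=> s0; split => [j|x j]; last by rewrite mxE; exact: (@bump_in _ _ _ _ _ (r0 j) _ _
      _ _ s0 (I0j j) (hd j) (rd j)).
  by split; [exact: bump_smooth|exact: bump_compact].
(* The constants belong to the undilated bumps [u 1] and so do not depend on [s]. *)
have [lo [hi [M [K [M0 K0 bI tu hK]]]]] := bellman_expansion (au 1 ltr01).
have u0 j : u 1 j 0 = z 0 j by exact: bump0.
have v0 : joint A (u 1) 0 = z by apply/rowP => j; rewrite mxE mul0mx u0.
have g0 : (fun j => grad_joint A (u 1) j 0) = w.
  apply/functional_extensionality_dep => j; apply/rowP => l; rewrite mxE mul0mx; exact:
      bump_partial0.
have zI : rectangle I z by rewrite -v0; exact: (au 1 ltr01).2.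
apply: (continuous_le0 (hess_form_continuous (w := w) (IU zI))) => e e0.
have [c c0 hc] := heat_vec_near C 0 M0 tu.
have gv := @gvar_gt0 R k k0.
have Kg0 : 0 <= 2 * K / gvar by rewrite divr_ge0 ?mulr_ge0// ltW.
(* [c] accounts for the distance from the averaged point to z, and [2 * K / gvar] for the remainder
   K s^3 divided by s^2 gvar / 2; D s < e controls both. *)
pose D := c + 2 * K / gvar + 1.
have D0 : 0 < D by rewrite ltr_wpDl// addr_ge0.
pose s := Num.min 1 (e / (2 * D)).
have s0 : 0 < s by rewrite lt_min ltr01 divr_gt0// mulr_gt0.
have s01 : 0 <= s <= 1 by rewrite (ltW s0) ge_min lexx.
have sD : D * s < e.
  have : s <= e / (2 * D) by rewrite ge_min lexx orbT.
  rewrite ler_pdivlMr ?mulr_gt0//; nra.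
exists (heat_vec C (s ^+ 2 / 2) (joint A (u 1)) 0).
  have := hc s s01; rewrite v0 => /le_lt_trans; apply; apply: le_lt_trans sD.
  by rewrite ler_wpM2r ?(ltW s0)// /D -addrA lerDl addr_ge0.
have E : joint A (u s) = fun x => joint A (u 1) (s *: x).
  apply/funext => x; apply/rowP => j; rewrite !mxE -scalemxAl; exact: bump_scale.
have := local_concave (au s s0).
have -> : heat C 2^-1 (B \o joint A (u s)) 0 = heat C (s ^+ 2 / 2) (B \o joint A (u 1)) 0.
  rewrite [LHS]heat_half [RHS](heat_scale C _ _ (ltW s0)); congr gexp; apply/funext => y.
  by rewrite /= E !add0r.
have -> : heat_vec C 2^-1 (joint A (u s)) 0 = heat_vec C (s ^+ 2 / 2) (joint A (u 1)) 0.
  apply/rowP => j.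
  rewrite [LHS]heat_vecE [RHS]heat_vecE [LHS]heat_half [RHS](heat_scale C _ _ (ltW s0)).
  congr gexp; apply/funext => y.
  by rewrite E !add0r.
have := hK _ _ tu 0 s s01; rewrite g0.
set m := heat_vec _ _ _ _; set H := hess_form _ _ _ _ _; set P := heat _ _ _ _.
rewrite ler_norml => /andP[h1 _] h2.
apply: (le_trans _ (ltW sD)); apply: (@le_trans _ _ (2 * K / gvar * s)); last first.
  by rewrite ler_wpM2r ?(ltW s0)// /D addrAC lerDr addr_ge0.
have h3 : s ^+ 2 * (gvar * H) <= s ^+ 2 * (2 * K * s).
  rewrite (_ : s ^+ 2 * (2 * K * s) = 2 * (K * s ^+ 3)); last by ring.
  rewrite (_ : s ^+ 2 * (gvar * H) = 2 * (s ^+ 2 / 2 * gvar * H)); last by field.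
  lra.
rewrite ler_pM2l ?exprn_gt0// in h3.
rewrite mulrAC ler_pdivlMr// mulrC //.
Qed.

Hypothesis I_nondegenerate : forall j, exists a b : R, [/\ a < b, a \in I j & b \in I j].

(** Moving z slightly towards the centre of a nondegenerate box inside the rectangle gives interior
    points arbitrarily close to z. *)
Lemma hess_form_le0 (z : 'rV[R]_n) (w : forall j, 'rV[R]_(k_ j)) : rectangle I z ->
    hess_form A C B z w <= 0.
Proof.
move=> Iz.
have /choice[a /choice[b hab]] := I_nondegenerate.
pose c : 'rV[R]_n := \row_j ((a j + b j) / 2).
apply: (continuous_le0 (hess_form_continuous (w := w) (IU Iz))) => e e0.
pose t := Num.min 1 (e / (2 * (`|c - z| + 1))).
have cz0 : 0 < `|c - z| + 1 by rewrite ltr_wpDl.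
have t0 : 0 < t by rewrite lt_min ltr01 divr_gt0// mulr_gt0.
have t1 : t <= 1 by rewrite ge_min lexx.
exists (z + t *: (c - z)).
  rewrite addrAC subrr add0r normrZ gtr0_norm//.
  have : t <= e / (2 * (`|c - z| + 1)) by rewrite ge_min lexx orbT.
  rewrite ler_pdivlMr ?mulr_gt0//; nra.
apply: le_trans (ltW e0); apply: hess_form_interior => j.
have [ab aI bI] := hab j.
(* The contraction towards z_j with ratio t maps [a_j, b_j] to the interval with this half-length
   around the new point. *)
exists (t * (b j - a j) / 2); first by rewrite divr_gt0// mulr_gt0// subr_gt0.
move=> y; rewrite !mxE ler_distl => /andP[y1 y2].
have conv q : q \in I j -> z 0 j + t * (q - z 0 j) \in I j.
  move=> qI; have zj := Iz j; have [zq|qz] := leP (z 0 j) q.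
    by apply: (interval_convex zj qI); apply/andP; split; nra.
  by apply: (interval_convex qI zj); apply/andP; split; nra.
apply: (interval_convex (conv _ aI) (conv _ bI)); apply/andP; split; lra.
Qed.

End Main.

Theorem theorem3 (R : realType) (n k : nat) (k_ : 'I_n -> nat)
    (n_gt0 : (0 < n)%N) (k_gt0 : (0 < k)%N) (k__gt0 : forall j, (0 < k_ j)%N)
    (A : forall j, 'M[R]_(k, k_ j))
    (I : 'I_n -> interval R) (Omega : set 'rV[R]_n)
    (Omega_rect : Omega = rectangle I)
    (I_nondegenerate : forall j, exists a b : R, [/\ a < b, a \in I j & b \in I j])
    (Omega0 : Omega 0)
    (B : 'rV[R]_n -> R)
    (B_smooth : exists U : set 'rV[R]_n,
        [/\ open U, Omega `<=` U & smooth_on U B])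
    (C : 'M[R]_k) (C_sym : C^T = C) (C_posdef : posdefmx C) :
  let cond_i :=
    forall z, Omega z -> negsemidefmx (block_hadamard A C (hessian B z)) in
  let cond_ii :=
    forall (t : R) (x : 'rV[R]_k) (u : forall j, 'rV[R]_(k_ j) -> R),
      0 <= t -> admissible A Omega u ->
      heat C t (B \o joint A u) x <= B (heat_vec C t (joint A u) x) in
  let cond_iii :=
    forall u : forall j, 'rV[R]_(k_ j) -> R,
      admissible A Omega u ->
      heat C 2^-1 (B \o joint A u) 0 <= B (heat_vec C 2^-1 (joint A u) 0) in
  (cond_i <-> cond_ii) /\ (cond_ii <-> cond_iii).
Proof.
move=> ci cii ciii; rewrite {}/ci {}/cii {}/ciii; subst Omega.
have [U [oU IU sB]] := B_smooth.
have C_psd : possemidefmx C.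
  move=> v; have [->|v0] := eqVneq v 0; last exact: ltW (C_posdef v v0).
  by rewrite !mul0mx mxE.
have [symS _ SS] := sqrtmxP C_sym C_psd.
(* Every row vector is assembled from its blocks, so test vectors and families [w] correspond. *)
have blockE z W : (W *m block_hadamard A C (hessian B z) *m W^T) 0 0 =
    hess_form A C B z (fun j => submxrow W j).
  by rewrite hess_form_block// submxrowK.
have i_ii : (forall z, rectangle I z -> negsemidefmx (block_hadamard A C (hessian B z))) ->
    forall (t : R) (x : 'rV[R]_k) (u : forall j, 'rV[R]_(k_ j) -> R),
    0 <= t -> admissible A (rectangle I) u ->
    heat C t (B \o joint A u) x <= B (heat_vec C t (joint A u) x).
  move=> hi t x u t0 au; apply: (heat_concave_admissible k_gt0 Omega0 IU sB) => // z w Iz.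
  by rewrite hess_form_block//; exact: hi.
have iii_i : (forall u, admissible A (rectangle I) u ->
      heat C 2^-1 (B \o joint A u) 0 <= B (heat_vec C 2^-1 (joint A u) 0)) ->
    forall z, rectangle I z -> negsemidefmx (block_hadamard A C (hessian B z)).
  move=> hiii z Iz W; rewrite blockE.
  exact: (hess_form_le0 k_gt0 Omega0 IU sB hiii I_nondegenerate).
split; split.
- exact: i_ii.
- by move=> h; apply: iii_i => u au; apply: h => //; rewrite invr_ge0.
- by move=> h u au; apply: h => //; rewrite invr_ge0.
- by move=> h t x u t0 au; apply: i_ii => //; exact: iii_i.
Qed.
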